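(* Let $m\ge3$ and $\beta>\beta_0(m)=\tfrac12\log(10(m-2))+\tfrac16$. Let $r,t\ge1$ be integers and for $n=1,2,\dots$ let $\gamma_n$ be an axis-parallel rectangular loop with side lengths $R_n=rn$ and $T_n=tn$. Then $$\lim_{n\to\infty}-\frac{1}{R_n+T_n}\log\langle W_{\gamma_n}\rangle_\beta=V_\beta,$$ where $V_\beta=\lim_{R\to\infty}V_\beta(R)$ and $V_\beta(R)=\lim_{T\to\infty}-\frac1T\log\langle W_{\gamma_{R,T}}\rangle_\beta$ (both limits exist).
   Context: Identify $\mathbb{Z}_2=\{0,1\}$, $\rho(g)=(-1)^g$. For $N\ge1$ let $B_N=[-N,N]^m\cap\mathbb{Z}^m$, and let $C_1(B_N)$, $C_2(B_N)$ be the oriented edges and oriented plaquettes with all vertices in $B_N$. A $\mathbb{Z}_2$-valued 1-form is a function $\sigma$ on $C_1(B_N)$ with $\sigma(-e)=-\sigma(e)$; $(d\sigma)(p)=\sum_{e\in\partial p}\sigma(e)$. For $\beta\ge0$, $\mu_{\beta,N}(\sigma)\propto\exp(\beta\sum_{p\in C_2(B_N)}\rho((d\sigma)(p)))$, with expectation $\mathbb{E}_{\beta,N}$. For a loop $\gamma$, $W_\gamma=\prod_{e\in\operatorname{supp}\gamma}\rho(\sigma(e))$ and $\langle W_\gamma\rangle_\beta=\lim_{N\to\infty}\mathbb{E}_{\beta,N}[W_\gamma]$. An axis-parallel rectangular loop with side lengths $R,T$ (denoted $\gamma_{R,T}$) is the boundary, traversed once, of a rectangle with those side lengths lying in a coordinate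 plane. *)

(* Defs.v *)
From mathcomp Require Import all_boot all_order all_algebra.
From mathcomp Require Import all_classical all_reals all_analysis.
Set Implicit Arguments. Unset Strict Implicit. Unset Printing Implicit Defensive.
Import Order.TTheory GRing.Theory Num.Theory numFieldNormedType.Exports.
Local Open Scope ring_scope.

(* Z_2 = {0,1} is represented by bool (false = 0, true = 1); addition in Z_2
   is xor (addb) and negation in Z_2 is the identity. *)
Definition rho {R : realType} (g : bool) : R := if g then -1 else 1.

Definition zvert (m : nat) := 'I_m -> int.
Definition zunit {m : nat} (k : 'I_m) : zvert m := fun l => ((l == k) : nat)%:Z.
Definition zadd {m : nat} (a b : zvert m) : zvert m := fun l => a l + b l.
Definition zscale {m : nat} (s : nat) (a : zvert m) : zvert m := fun l => s%:Z * a l.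

(* A positively oriented edge of Z^m: (x, k) is the edge from x to x + e_k.
   For Z_2-valued 1-forms sigma(-e) = -sigma(e) = sigma(e), so rho(sigma(e))
   does not depend on the orientation of e. *)

(* Support of the axis-parallel rectangular loop lying in the coordinate plane
   spanned by e_i, e_j (i <> j), with corner a, side length R in direction e_i
   and side length T in direction e_j (each edge listed once, positively
   oriented). *)
Definition rect_edges {m : nat} (i j : 'I_m) (a : zvert m) (R T : nat)
  : seq (zvert m * 'I_m) :=
  [seq (zadd a (zscale s (zunit i)), i) | s <- iota 0 R] ++
  [seq (zadd (zadd a (zscale T (zunit j))) (zscale s (zunit i)), i) | s <- iota 0 R] ++
  [seq (zadd a (zscale s (zunit j)), j) | s <- iota 0 T] ++
  [seq (zadd (zadd a (zscale R (zunit i))) (zscale s (zunit j)), j) | s <- iota 0 T].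

(* A vertex y of B_N is stored as x with x k = y k + N in {0,..,2N}. *)
Definition bvert (m N : nat) := {ffun 'I_m -> 'I_(2 * N).+1}.

(* Positive edge (x,k) of B_N: both x and x + e_k in B_N. *)
Definition bedge_ok {m N : nat} (e : bvert m N * 'I_m) : bool :=
  (e.1 e.2 < 2 * N)%N.

(* x + e_k (only used when x k < 2N). *)
Definition bshift {m N : nat} (x : bvert m N) (k : 'I_m) : bvert m N :=
  [ffun l => if l == k then inord (x l).+1 else x l].

(* A Z_2-valued 1-form on B_N: value on each positively oriented edge of B_N
   (the value on the reversed edge is determined by antisymmetry);
   we store it as a function vanishing off the edge set. *)
Definition bconf (m N : nat) := {ffun bvert m N * 'I_m -> bool}.
Definition bconf_ok {m N : nat} (sigma : bconf m N) : bool :=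
  [forall e, ~~ bedge_ok e ==> ~~ sigma e].

(* Positively oriented plaquette (x; e_i, e_j), i < j, with all vertices in B_N. *)
Definition bplaq_ok {m N : nat} (x : bvert m N) (i j : 'I_m) : bool :=
  [&& (i < j)%N, (x i < 2 * N)%N & (x j < 2 * N)%N].

(* (d sigma)(p) = sigma(x,e_i) + sigma(x+e_i,e_j) - sigma(x+e_j,e_i) - sigma(x,e_j)
   in Z_2 (where minus = plus). *)
Definition dsig {m N : nat} (sigma : bconf m N) (x : bvert m N) (i j : 'I_m) : bool :=
  sigma (x, i) (+) sigma (bshift x i, j) (+) sigma (bshift x j, i) (+) sigma (x, j).

(* Sum over ALL oriented plaquettes of C_2(B_N): each positively oriented
   plaquette p appears with both orientations o (o = false is -p), and
   (d sigma)(-p) = -(d sigma)(p) = (d sigma)(p) in Z_2. *)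
Definition action {R : realType} {m N : nat} (sigma : bconf m N) : R :=
  \sum_(q : bvert m N * 'I_m * 'I_m * bool | bplaq_ok q.1.1.1 q.1.1.2 q.1.2)
     rho (dsig sigma q.1.1.1 q.1.1.2 q.1.2).

Definition gibbs_weight {R : realType} {m N : nat} (beta : R) (sigma : bconf m N) : R :=
  expR (beta * action sigma).

Definition expect {R : realType} {m N : nat} (beta : R) (f : bconf m N -> R) : R :=
  (\sum_(sigma : bconf m N | bconf_ok sigma) f sigma * gibbs_weight beta sigma) /
  (\sum_(sigma : bconf m N | bconf_ok sigma) gibbs_weight beta sigma).

(* Vertex of Z^m to vertex of B_N (meaningful when the vertex lies in B_N,
   which holds for all N large enough for any fixed finite loop). *)
Definition to_box {m : nat} (N : nat) (v : zvert m) : bvert m N :=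
  [ffun k => inord (absz (v k + N%:Z))].

Definition wilson {R : realType} {m : nat} (N : nat) (es : seq (zvert m * 'I_m))
  (sigma : bconf m N) : R :=
  \prod_(e <- es) rho (sigma (to_box N e.1, e.2)).

Definition wilson_exp {R : realType} {m : nat} (beta : R) (es : seq (zvert m * 'I_m)) : R :=
  limn (fun N : nat => expect (N := N) beta (wilson es)).

Definition rect_wilson {R : realType} {m : nat} (beta : R) (i j : 'I_m) (a : zvert m)
  (Rl Tl : nat) : R :=
  wilson_exp beta (rect_edges i j a Rl Tl).

(* Main.v *)
Require Import Defs.
From mathcomp Require Import all_boot all_order all_algebra finmap fingroup perm.
From mathcomp Require Import all_classical all_reals all_analysis.
From mathcomp Require Import ring lra zify.
Set Implicit Arguments. Unset Strict Implicit. Unset Printing Implicit Defensive.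
Import Order.TTheory GRing.Theory Num.Theory numFieldNormedType.Exports.
Local Open Scope fset_scope.
Local Open Scope ring_scope.

(**
By the Poincare lemma on the box, the curvature of a configuration is an
arbitrary closed set of plaquettes, with weight [exp(-4 beta)] per plaquette, and
a rectangular Wilson loop is the parity of the plaquettes it shares with the flat
spanning rectangle.  This is a polymer gas at small activity.  The functions of a
finite set of plaquettes form, under the weighted l1-norm of their Moebius
transforms, a Banach algebra, so that the recursion of Dobrushin and
Kotecky-Preiss bounds in this norm the ratios of partition functions and their
logarithms; hence log <W> is a sum over connected sets of plaquettes whose
contributions decay exponentially with the cardinal.

Write [f R T] for -log <W> in infinite volume.  Comparing the rectangles with
vertical sides [0, T+2], [1, T+1], [0, T+1], [1, T+2], only sets reaching from the
bottom row to the top row contribute to the second difference of [f R] at [T],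
which is therefore [O(R s^-T)].  Replacing the flat rectangle by the other five
faces of a box standing on it (this needs a third direction) shows that only
sets comparable in size to their distance to the loop contribute, whence
[f R T = O(R + T)].  These two bounds and the symmetry of [f] force
[f R T = V (R + T) + o(R + T)].
*)

(** * Moebius transforms and their weighted norm *)

(** The Wilson loop is put into the weight, so that numerator and denominator of the expectation are
    partition functions of two gases with the same activity. The price is signed weights: positivity
    of the partition functions, without which there is no logarithm, has to come out of the same
    induction that bounds their ratios.

    The obstacle is the area. The clusters meeting the flat rectangle are as numerous as its
    plaquettes, and a direct estimate yields only an area bound; closedness of the curvature is what
    shows that a small cluster in the interior does not feel the loop. Even the second difference,
    though exponentially small in the height, is proportional to the width; hence the height at
    which the rectangle is cut is fixed before the rectangle grows.

    The threshold enters only through [exp(-4 beta) < (10 (m - 2))^-2 exp(-2/3)]. A plaquette has at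
    most [12 (m - 2)] neighbours, and the convergence condition then holds with cluster decay
    [s = 4/3] and smallness [t = (36 (m - 2))^-1]. *)

Lemma sum_reindex_seq (V : nmodType) (I J : eqType) (s : seq I) (s' : seq J)
    (h : I -> J) (F : J -> V) :
  uniq s -> uniq s' -> {in s &, injective h} -> s' =i map h s ->
  \sum_(y <- s') F y = \sum_(x <- s) F (h x).
Proof.
move=> us us' hi e; rewrite -(big_map h predT F); apply: perm_big.
by apply: uniq_perm => //; rewrite map_inj_in_uniq.
Qed.

Lemma ler_sum_inj_seq (R : numDomainType) (I J : eqType) (s : seq I) (s' : seq J)
    (h : I -> J) (F : J -> R) :
  uniq s -> uniq s' -> {in s &, injective h} ->
  (forall x, x \in s -> h x \in s') -> (forall y, y \in s' -> 0 <= F y) ->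
  \sum_(x <- s) F (h x) <= \sum_(y <- s') F y.
Proof.
move=> us us' hi hs F0.
rewrite (bigID (mem (map h s)) predT) /=.
have -> : \sum_(x <- s) F (h x) = \sum_(y <- s' | y \in map h s) F y.
  rewrite -(big_filter s'); apply/esym; apply: sum_reindex_seq => //.
    exact: filter_uniq.
  move=> y; rewrite mem_filter; case: mapP => //= -[x xs ->]; exact: hs.
by rewrite lerDl big_seq_cond; apply: sumr_ge0 => y /andP[/F0].
Qed.

Section Moebius.
Variables (R : realType) (K : choiceType).
Implicit Types (A B C D E P U : {fset K}) (p q : K) (g h u v : {fset K} -> R).

Lemma sum_fpowerset0 (F : {fset K} -> R) : \sum_(B <- fpowerset fset0) F B = F fset0.
Proof. by rewrite fpowerset0 big_seq_fset1. Qed.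

Lemma sum_fpowersetU1 (F : {fset K} -> R) p A : p \notin A ->
  \sum_(B <- fpowerset (p |` A)) F B =
  \sum_(B <- fpowerset A) F B + \sum_(B <- fpowerset A) F (p |` B).
Proof.
move=> pA.
have inj : {in fpowerset A &, injective (fun B => p |` B)}.
  move=> B C; rewrite !fpowersetE => /fsubsetP BA /fsubsetP CA e.
  apply/fsetP => z; have := congr1 (fun X : {fset K} => z \in X) e; rewrite !inE.
  case: eqVneq => //= -> _.
  by rewrite (contraNF (BA p) pA) (contraNF (CA p) pA).
rewrite -[\sum_(B <- fpowerset A) F (_ |` _)](big_map (fun B => p |` B) predT F).
rewrite -big_cat; apply: perm_big; apply: uniq_perm => //.
  rewrite cat_uniq fset_uniq map_inj_in_uniq ?fset_uniq // andbT.
  apply/hasPn => _ /mapP[B BA ->] /=; rewrite fpowersetE.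
  by apply: contraNN pA => /fsubsetP; apply; rewrite !inE eqxx.
move=> B; rewrite mem_cat !fpowersetE; apply/idP/idP.
  move=> /fsubsetP BA; case: (boolP (p \in B)) => pB; last first.
    apply/orP; left; apply/fsubsetP => z zB; have := BA z zB; rewrite !inE.
    by case: eqVneq => // zp; rewrite -zp zB in pB.
  apply/orP; right; apply/mapP; exists (B `\ p); last by rewrite fsetD1K.
  rewrite fpowersetE; apply/fsubsetP => z; rewrite !inE => /andP[zp /BA].
  by rewrite !inE (negPf zp).
case/orP => [/fsubset_trans|/mapP[C]]; first by apply; rewrite fsubsetU1.
by rewrite fpowersetE => CA ->; apply: fsetUS.
Qed.

Lemma sum_fpowerset_sub (F : {fset K} -> R) A B : B `<=` A ->
  \sum_(C <- fpowerset A | C `<=` B) F C = \sum_(C <- fpowerset B) F C.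
Proof.
move=> BA; rewrite -big_filter; apply: perm_big; apply: uniq_perm => //.
  exact/filter_uniq/fset_uniq.
move=> C; rewrite mem_filter !fpowersetE andb_idr // => /fsubset_trans; exact.
Qed.

Lemma sum_if_eq (I : eqType) (r : seq I) (d : I) (c : R) : uniq r ->
  \sum_(D <- r) (if d == D then c else 0) = if d \in r then c else 0.
Proof.
move=> ur; case: ifP => dr; last first.
  by rewrite big_seq big1 // => D Dr; case: eqP => // dD; rewrite dD Dr in dr.
rewrite (bigD1_seq d) //= eqxx big1 ?addr0 // => D; rewrite eq_sym.
by move/negPf ->.
Qed.

(** The exponent adds the two cardinals: it has the parity of their difference, without truncated
    subtraction. *)
Definition mob g C : R :=
  \sum_(B <- fpowerset C) (-1) ^+ (#|` C| + #|` B|) * g B.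

Lemma eq_mob g h C : (forall B, B `<=` C -> g B = h B) -> mob g C = mob h C.
Proof.
by move=> e; rewrite /mob big_seq [RHS]big_seq; apply: eq_bigr => B;
  rewrite fpowersetE => /e ->.
Qed.

Lemma mob0 g : mob g fset0 = g fset0.
Proof. by rewrite /mob sum_fpowerset0 cardfs0 expr0 mul1r. Qed.

Lemma mobU1 g p C : p \notin C ->
  mob g (p |` C) = mob (fun B => g (p |` B)) C - mob g C.
Proof.
move=> pC; rewrite /mob sum_fpowersetU1 // addrC -sumrN; congr (_ + _).
  rewrite big_seq [RHS]big_seq; apply: eq_bigr => B; rewrite fpowersetE => BC.
  have pB : p \notin B by apply: contraNN pC; move/fsubsetP: BC; apply.
  by rewrite !cardfsU1 pC pB !add1n addSn addnS !exprS mulrA mulrNN !mul1r.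
by apply: eq_bigr => B _; rewrite cardfsU1 pC add1n addSn exprS mulN1r mulNr.
Qed.

(** Moebius inversion in the form used to compute a transform: guess it, then check that its sums
    over subsets recover [g]. *)
Lemma mob_unique g u C :
  (forall B, B `<=` C -> g B = \sum_(D <- fpowerset B) u D) -> mob g C = u C.
Proof.
elim/fset1U_rect: C g u => [|p C pC IH] g u e.
  by rewrite mob0 e ?fsub0set // sum_fpowerset0.
rewrite mobU1 // (IH g u); last by move=> B BC; apply: e; rewrite fsubsetU ?BC ?orbT.
rewrite (IH (fun B => g (p |` B)) (fun D => u D + u (p |` D))) => [|B BC].
  by rewrite addrC addKr.
rewrite e ?fsetUS // sum_fpowersetU1 ?big_split //.
by apply: contraNN pC; move/fsubsetP: BC; apply.
Qed.

Lemma sum_mob g A : \sum_(C <- fpowerset A) mob g C = g A.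
Proof.
elim/fset1U_rect: A g => [|p A pA IH] g; first by rewrite sum_fpowerset0 mob0.
rewrite sum_fpowersetU1 // -(IH (fun B => g (p |` B))) -big_split /=.
rewrite big_seq [RHS]big_seq; apply: eq_bigr => C; rewrite fpowersetE => CA.
by rewrite mobU1 1?addrC ?subrK //; apply: contraNN pA; move/fsubsetP: CA; apply.
Qed.

Lemma mobD g h C : mob (fun B => g B + h B) C = mob g C + mob h C.
Proof. by rewrite /mob -big_split; apply: eq_bigr => B _; rewrite mulrDr. Qed.

Lemma mobZ (c : R) g C : mob (fun B => c * g B) C = c * mob g C.
Proof. by rewrite /mob big_distrr; apply: eq_bigr => B _; rewrite mulrCA. Qed.

Lemma mob_sumf (I : Type) (r : seq I) (G : I -> {fset K} -> R) C :
  mob (fun B => \sum_(i <- r) G i B) C = \sum_(i <- r) mob (G i) C.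
Proof.
by rewrite /mob exchange_big; apply: eq_bigr => B _; rewrite big_distrr.
Qed.

(** By [mobU1] the transform contains the finite difference in the direction of [p]. This is what
    makes clusters vanish later. *)
Lemma mob_indep g p C : p \in C ->
  (forall B, B `<=` C -> g (p |` B) = g B) -> mob g C = 0.
Proof.
move=> pC e; rewrite -(fsetD1K pC) mobU1 ?in_fsetD1 ?eqxx //.
rewrite (eq_mob (h := g)) ?subrr // => B BC; apply: e.
exact: fsubset_trans BC (fsubD1set _ _).
Qed.

Variable s : R.
Hypothesis s1 : 1 <= s.

Let s0 : 0 <= s. Proof. exact: le_trans s1. Qed.

(* Submultiplicative because [#|` C `|` D| <= #|` C| + #|` D|]. *)
Definition mnorm A g : R := \sum_(C <- fpowerset A) `|mob g C| * s ^+ #|` C|.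

Lemma mnorm_ge0 A g : 0 <= mnorm A g.
Proof. by apply: sumr_ge0 => C _; rewrite mulr_ge0 ?exprn_ge0. Qed.

Lemma eq_mnorm A g h : (forall B, B `<=` A -> g B = h B) -> mnorm A g = mnorm A h.
Proof.
move=> e; rewrite /mnorm big_seq [RHS]big_seq; apply: eq_bigr => C.
rewrite fpowersetE => CA; rewrite (eq_mob (h := h)) // => B BC.
exact: e (fsubset_trans BC CA).
Qed.

Lemma ler_mnorm A B g : B `<=` A -> `|g B| <= mnorm A g.
Proof.
move=> BA; rewrite -(sum_mob g B); apply: le_trans (ler_norm_sum _ _ _) _.
apply: (@le_trans _ _ (\sum_(C <- fpowerset B) `|mob g C| * s ^+ #|` C|)).
  by apply: ler_sum => C _; rewrite ler_peMr // exprn_ege1.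
apply: (ler_sum_inj_seq (h := id)) => //.
- by move=> C; rewrite !fpowersetE => /fsubset_trans; apply.
- by move=> C _; rewrite mulr_ge0 ?exprn_ge0.
Qed.

Lemma mnormD A g h : mnorm A (fun B => g B + h B) <= mnorm A g + mnorm A h.
Proof.
rewrite /mnorm -big_split; apply: ler_sum => C _ /=.
by rewrite mobD -mulrDl ler_wpM2r ?exprn_ge0 // ler_normD.
Qed.

Lemma mnormZ A c g : mnorm A (fun B => c * g B) = `|c| * mnorm A g.
Proof.
by rewrite /mnorm big_distrr; apply: eq_bigr => C _ /=; rewrite mobZ normrM mulrA.
Qed.

Lemma mnorm_sum A (I : Type) (r : seq I) (G : I -> {fset K} -> R) :
  mnorm A (fun B => \sum_(i <- r) G i B) <= \sum_(i <- r) mnorm A (G i).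
Proof.
rewrite /mnorm exchange_big; apply: ler_sum => C _ /=.
by rewrite mob_sumf -big_distrl ler_wpM2r ?exprn_ge0 // ler_norm_sum.
Qed.

(** The transform of this indicator is the point mass at [P]. *)
Lemma mnorm_ind A P : mnorm A (fun B => (P `<=` B)%:R) <= s ^+ #|` P|.
Proof.
have e C : mob (fun B => (P `<=` B)%:R) C = if P == C then 1 else 0.
  apply: (mob_unique (u := fun C => if P == C then 1 else 0)) => B _.
  by rewrite sum_if_eq ?fset_uniq // fpowersetE; case: (_ `<=` _).
rewrite /mnorm (eq_bigr (fun C => if P == C then s ^+ #|` P| else 0)); last first.
  by move=> C _; rewrite e; case: eqP => [->|]; rewrite ?normr1 ?mul1r // normr0 mul0r.
by rewrite sum_if_eq ?fset_uniq //; case: ifP; rewrite ?exprn_ge0.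
Qed.

Lemma mnorm_cst A c : mnorm A (fun=> c) <= `|c|.
Proof.
rewrite (eq_mnorm (h := fun B => c * (fset0 `<=` B)%:R)); last first.
  by move=> B _; rewrite fsub0set mulr1.
by rewrite mnormZ ler_piMr // (le_trans (mnorm_ind _ _)) // cardfs0.
Qed.

Lemma mnormM A g h : mnorm A (fun B => g B * h B) <= mnorm A g * mnorm A h.
Proof.
(* The transform of a product is the convolution of the transforms with respect to union. *)
pose a C1 C2 := mob g C1 * mob h C2.
pose u C := \sum_(C1 <- fpowerset A) \sum_(C2 <- fpowerset A)
  (if C1 `|` C2 == C then a C1 C2 else 0).
have e C : C `<=` A -> mob (fun B => g B * h B) C = u C.
  move=> CA; apply: mob_unique => B BC; have BA := fsubset_trans BC CA.
  rewrite exchange_big /= -(sum_mob g B) -(sum_mob h B) big_distrl /=.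
  rewrite -(sum_fpowerset_sub _ BA) big_mkcond; apply: eq_bigr => C1 _.
  rewrite exchange_big /=.
  under [RHS]eq_bigr do rewrite sum_if_eq ?fset_uniq // fpowersetE fsubUset.
  case: (C1 `<=` B) => /=; last by rewrite big1.
  by rewrite -big_mkcond sum_fpowerset_sub // big_distrr.
rewrite /mnorm big_seq.
rewrite (eq_bigr (fun C => `|u C| * s ^+ #|` C|)) -?big_seq; last first.
  by move=> C; rewrite fpowersetE => CA; rewrite e.
pose b C1 C2 := `|mob g C1| * s ^+ #|` C1| * (`|mob h C2| * s ^+ #|` C2|).
apply: (@le_trans _ _ (\sum_(C <- fpowerset A) \sum_(C1 <- fpowerset A)
    \sum_(C2 <- fpowerset A) (if C1 `|` C2 == C then b C1 C2 else 0))).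
  apply: ler_sum => C _; rewrite /u.
  apply: le_trans (ler_wpM2r _ (ler_norm_sum _ _ _)) _; first by rewrite exprn_ge0.
  rewrite big_distrl; apply: ler_sum => C1 _ /=.
  apply: le_trans (ler_wpM2r _ (ler_norm_sum _ _ _)) _; first by rewrite exprn_ge0.
  rewrite big_distrl; apply: ler_sum => C2 _ /=.
  case: eqP => [<-|_]; last by rewrite normr0 mul0r.
  rewrite /a /b normrM mulrACA ler_wpM2l ?mulr_ge0 // -exprD ler_weXn2l //.
  by rewrite -cardfsUI leq_addr.
rewrite exchange_big /= big_distrl /= big_seq [leRHS]big_seq; apply: ler_sum => C1.
rewrite fpowersetE => C1A; rewrite exchange_big /= big_distrr /= big_seq [leRHS]big_seq.
apply: ler_sum => C2; rewrite fpowersetE => C2A.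
by rewrite sum_if_eq ?fset_uniq // fpowersetE fsubUset C1A C2A.
Qed.

(** The inverse satisfies [v = 1 - u v], whence [mnorm A v <= 1 + t * mnorm A v]. The norm is a
    finite sum, so this can be solved directly, without a Neumann series. *)
Lemma mnorm_inv1D A u (t : R) : mnorm A u <= t -> t < 1 ->
  mnorm A (fun B => (1 + u B)^-1) <= (1 - t)^-1.
Proof.
move=> ut t1; set v := fun B => _; have t1' : 0 < 1 - t by rewrite subr_gt0.
have nz B : B `<=` A -> 1 + u B != 0.
  move=> BA; have := le_lt_trans (le_trans (ler_mnorm u BA) ut) t1.
  by rewrite ltr_norml => /andP[uB _]; rewrite gt_eqF // -ltrBlDl sub0r.
have : mnorm A v <= 1 + t * mnorm A v.
  rewrite [leLHS](eq_mnorm (h := fun B => 1 + (-1) * (u B * v B))); last first.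
    move=> B BA; rewrite mulN1r; apply/eqP; rewrite eq_sym subr_eq.
    by rewrite -[X in X + _]mul1r -mulrDl divff ?nz.
  rewrite (le_trans (mnormD _ _ _)) // lerD //.
    by rewrite (le_trans (mnorm_cst _ _)) // normr1.
  rewrite mnormZ normrN1 mul1r; apply: le_trans (mnormM _ _ _) _.
  by rewrite ler_wpM2r ?mnorm_ge0.
by move=> H; rewrite -[leRHS]mul1r ler_pdivlMr // mulrBr mulr1 lerBlDr mulrC.
Qed.

(** The constant is huge and depends on [A]; it only multiplies an error that tends to zero while
    [A] is fixed. *)
Lemma mnorm_le_sup A g (e : R) : (forall B, B `<=` A -> `|g B| <= e) ->
  mnorm A g <= (\sum_(C <- fpowerset A) \sum_(B <- fpowerset C) s ^+ #|` C|) * e.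
Proof.
move=> ge; rewrite big_distrl /= /mnorm big_seq [leRHS]big_seq; apply: ler_sum => C.
rewrite fpowersetE => CA.
apply: le_trans (ler_wpM2r _ (ler_norm_sum _ _ _)) _; first by rewrite exprn_ge0.
rewrite !big_distrl /= big_seq [leRHS]big_seq; apply: ler_sum => B.
rewrite fpowersetE => BC; rewrite normrM normrX normrN1 expr1n mul1r mulrC.
by rewrite ler_wpM2l ?exprn_ge0 // ge // (fsubset_trans BC).
Qed.

Lemma ln1D_sub_le (x : R) : `|x| <= 2^-1 -> `|ln (1 + x) - x| <= 2 * x ^+ 2.
Proof.
rewrite ler_norml => /andP[x1 x2].
have x0 : 0 < 1 + x by lra.
have h1 : ln (1 + x) <= x by apply: le_ln1Dx; lra.
have h2 : - ln (1 + x) <= - x + 2 * x ^+ 2.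
  rewrite -lnV ?posrE //.
  have -> : (1 + x)^-1 = 1 + (- x / (1 + x)) by field; lra.
  apply: le_trans (le_ln1Dx _) _.
    rewrite ltr_pdivlMr //; lra.
  rewrite ler_pdivrMr //; nra.
have x20 : 0 <= x ^+ 2 by rewrite sqr_ge0.
by rewrite ler_norml; apply/andP; split; lra.
Qed.

Lemma split_step (M k x : R) : 0 < M -> 0 < 1 + k / M * x ->
  1 + M^-1 * (x / (1 + k / M * x)) = (1 + (k + 1) / M * x) / (1 + k / M * x).
Proof.
move=> M0 h; have h2 : 0 < M + k * x.
  by have := mulr_gt0 M0 h; rewrite mulrDr mulr1 mulrA mulrCA divff ?mulr1 // gt_eqF.
by field; rewrite !gt_eqF.
Qed.

(* Split [1 + u] into [M] factors [(1 + (k+1) u/M) / (1 + k u/M)], linearise the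
   logarithm of each one, and let [M] tend to infinity. *)
Lemma mnorm_ln1D A u (t : R) : mnorm A u <= t -> t < 1 ->
  mnorm A (fun B => ln (1 + u B)) <= t / (1 - t).
Proof.
move=> ut t1; have t0 : 0 <= t := le_trans (mnorm_ge0 _ _) ut.
have ub B : B `<=` A -> `|u B| <= t by move=> /ler_mnorm /le_trans; apply.
set c := \sum_(C <- fpowerset A) \sum_(B <- fpowerset C) s ^+ #|` C|.
have c0 : 0 <= c.
  by apply: sumr_ge0 => C _; apply: sumr_ge0 => B _; rewrite exprn_ge0.
set b := t / (1 - t); have b0 : 0 <= b by rewrite divr_ge0 // subr_ge0 ltW.
(* The condition keeps every [v k] within one half in absolute value, where the quadratic estimate
   of [ln] holds. The linear terms add up to [b], the remainders to a multiple of the inverse of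
   [M.+1]. *)
have key (M : nat) : 2 * b < M.+1%:R ->
    mnorm A (fun B => ln (1 + u B)) <= b + c * (2 * b ^+ 2) / M.+1%:R.
  move=> bM; set M' : R := M.+1%:R; have M0 : 0 < M' by rewrite ltr0n.
  have M0' := ltW M0.
  pose z k B := k%:R / M' * u B.
  pose v k B := M'^-1 * (u B * (1 + z k B)^-1).
  have zt k : (k <= M)%N -> mnorm A (z k) <= t.
    move=> kM; rewrite mnormZ ger0_norm ?divr_ge0 ?ler0n //.
    apply: le_trans ut; rewrite ler_piMl ?mnorm_ge0 // ler_pdivrMr // mul1r.
    by rewrite ler_nat ltnW.
  have vb k : (k <= M)%N -> mnorm A (v k) <= b / M'.
    move=> kM; rewrite mnormZ ger0_norm ?invr_ge0 // mulrC ler_wpM2r ?invr_ge0 //.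
    apply: le_trans (mnormM _ _ _) _; rewrite ler_pM ?mnorm_ge0 //.
    exact: mnorm_inv1D (zt _ kM) t1.
  have z1 k B : B `<=` A -> (k <= M.+1)%N -> 0 < 1 + z k B.
    move=> BA kM; have : `|z k B| <= t.
      rewrite normrM ger0_norm ?divr_ge0 ?ler0n //.
      apply: le_trans (ub _ BA); rewrite ler_piMl // ler_pdivrMr // mul1r.
      by rewrite ler_nat.
    by rewrite ler_norml => /andP[]; lra.
  have step k B : B `<=` A -> (k <= M)%N ->
      ln (1 + v k B) = ln (1 + z k.+1 B) - ln (1 + z k B).
    move=> BA kM; rewrite -ln_div ?posrE ?z1 //; last exact: leqW.
    congr (ln _); have := z1 k B BA (leqW kM); rewrite /v /z => h.
    by rewrite -natr1; exact: split_step.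
  have tel B : B `<=` A -> ln (1 + u B) = \sum_(k < M.+1) ln (1 + v k B).
    move=> BA; rewrite (eq_bigr (fun k : 'I_M.+1 => ln (1 + z k.+1 B) - ln (1 + z k B))).
      rewrite -(big_mkord xpredT (fun k => ln (1 + z k.+1 B) - ln (1 + z k B))).
      rewrite telescope_sumr // /z mul0r mul0r addr0 ln1 subr0 divff ?gt_eqF //.
      by rewrite mul1r.
    by move=> k _; rewrite step // -ltnS.
  rewrite (eq_mnorm tel).
  apply: le_trans (mnorm_sum _ _ _) _.
  apply: (@le_trans _ _ (\sum_(k < M.+1) (b / M' + c * (2 * (b / M') ^+ 2)))).
    apply: ler_sum => k _; have kM : (k <= M)%N by rewrite -ltnS.
    rewrite (eq_mnorm (h := fun B => v k B + (ln (1 + v k B) - v k B))); last first.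
      by move=> B _; rewrite subrKC.
    apply: le_trans (mnormD _ _ _) _; rewrite lerD ?vb //.
    apply: mnorm_le_sup => B BA.
    have vB : `|v k B| <= b / M' := le_trans (ler_mnorm _ BA) (vb _ kM).
    apply: le_trans (ln1D_sub_le _) _.
      by apply: le_trans vB _; rewrite ler_pdivrMr //; lra.
    rewrite ler_wpM2l //.
    rewrite -(real_normK (num_real (v k B))); apply: lerXn2r => //; rewrite nnegrE //.
    exact: le_trans vB.
  rewrite sumr_const card_ord -mulr_natl -/M' le_eqVlt; apply/orP; left; apply/eqP.
  by field; lra.
apply/ler_addgt0Pr => e e0.
pose M := Num.truncn (2 * b + c * (2 * b ^+ 2) / e).
have hM : 2 * b + c * (2 * b ^+ 2) / e < M.+1%:R by exact: truncnS_gt.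
have ce : 0 <= c * (2 * b ^+ 2) / e.
  by apply: divr_ge0; [apply: mulr_ge0 => //; apply: mulr_ge0 => //; apply: sqr_ge0|apply: ltW].
have bM : 2 * b < M.+1%:R by lra.
apply: le_trans (key M bM) _; rewrite lerD2l ler_pdivrMr ?ltr0n //.
rewrite [leRHS]mulrC -ler_pdivrMr //; lra.
Qed.

End Moebius.

(** * Connected components and lattice animals *)

Section Components.
Variables (K : choiceType) (nb : K -> seq K).
Hypothesis nb_refl : forall p, p \in nb p.
Implicit Types (B C E P U : {fset K}) (p q : K) (l : seq K).

Definition gclosed U B := all (fun u => all (fun v => (v \in B) ==> (v \in U)) (nb u)) U.

Lemma gclosedP U B :
  reflect (forall u v, u \in U -> v \in nb u -> v \in B -> v \in U) (gclosed U B).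
Proof.
apply: (iffP allP) => [H u v uU vu vB|H u uU].
  by move/allP: (H u uU) => /(_ v vu) /implyP; apply.
by apply/allP => v vu; apply/implyP; apply: H vu.
Qed.

(** Every point of [P] can be reached inside [P] from the members of [l] that it contains: the
    vertex set of a forest with roots in [l]. *)
Definition rooted l P :=
  all (fun U => all (fun q => (q \in P) ==> (q \in U)) l && gclosed U P ==> (U == P))
      (fpowerset P).

Lemma rootedP l P :
  reflect (forall U, U `<=` P -> {in l, forall q, q \in P -> q \in U} ->
             gclosed U P -> U = P) (rooted l P).
Proof.
apply: (iffP allP) => [H U UP lU cU|H U].
  have := H U; rewrite fpowersetE UP cU andbT => /(_ isT) /implyP h.
  by apply/eqP/h/allP => q ql; apply/implyP; apply: lU.
rewrite fpowersetE => UP; apply/implyP => /andP[/allP lU cU]; apply/eqP/H => //.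
by move=> q ql; apply/implyP/lU.
Qed.

Definition conn p P := (p \in P) && rooted [:: p] P.

Lemma connP p P : p \in P ->
  reflect (forall U, U `<=` P -> p \in U -> gclosed U P -> U = P) (conn p P).
Proof.
move=> pP; rewrite /conn pP; apply: (iffP (rootedP _ _)) => H U UP.
  by move=> pU; apply: H => // q; rewrite inE => /eqP ->.
by move=> /(_ p (mem_head _ _) pP); apply: H.
Qed.

(* The smallest closed subset of [B] containing [p]; no paths are involved. *)
Definition component p B : {fset K} :=
  [fset q in B | all (fun U => (p \in U) && gclosed U B ==> (q \in U)) (fpowerset B)].

Lemma componentP p B q :
  reflect (q \in B /\ forall U, U `<=` B -> p \in U -> gclosed U B -> q \in U)
          (q \in component p B).
Proof.
rewrite !inE; apply: (iffP andP) => -[qB H]; split=> //.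
  move=> U UB pU cU; move/allP: H => /(_ U); rewrite fpowersetE UB pU cU.
  by move/(_ isT).
apply/allP => U; rewrite fpowersetE => UB; apply/implyP => /andP[pU cU]; exact: H.
Qed.

Lemma component_sub p B : component p B `<=` B.
Proof. by apply/fsubsetP => q /componentP[]. Qed.

Lemma mem_component p B : p \in B -> p \in component p B.
Proof. by move=> pB; apply/componentP. Qed.

Lemma gclosed_component p B : gclosed (component p B) B.
Proof.
apply/gclosedP => u v /componentP[uB H] vu vB; apply/componentP; split=> //.
move=> U UB pU cU; apply: (gclosedP _ _ cU u v _ vu vB); exact: H.
Qed.

Lemma conn_component p B : p \in B -> conn p (component p B).
Proof.
move=> pB; apply/connP; first exact: mem_component.
move=> U UC pU cU; apply/eqP; rewrite eqEfsubset UC; apply/fsubsetP => q /componentP[_].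
apply=> //; first exact: fsubset_trans UC (component_sub _ _).
apply/gclosedP => u v uU vu vB; apply: (gclosedP _ _ cU u v uU vu).
apply: (gclosedP _ _ (gclosed_component p B) u v _ vu vB).
by move/fsubsetP: UC; apply.
Qed.

Lemma component_unique p P B : conn p P -> P `<=` B -> gclosed P B -> component p B = P.
Proof.
move=> cP PB clP; have pP : p \in P by case/andP: cP.
have sub : component p B `<=` P by apply/fsubsetP => q /componentP[_]; apply.
have pB : p \in B by move/fsubsetP: PB; apply.
move/connP: cP => /(_ pP); apply=> //; first exact: mem_component.
apply/gclosedP => u v uC vu vP; apply: (gclosedP _ _ (gclosed_component p B) u v uC vu).
by move/fsubsetP: PB; apply.
Qed.

(** A list rather than a set is removed, so that ratios of partition functions can be telescoped
    along it, one point at a time. *)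
Definition remseq E l : {fset K} := [fset q in E | q \notin l].
Definition nbs P : seq K := flatten [seq nb u | u <- P].

Lemma in_remseq E l q : (q \in remseq E l) = (q \in E) && (q \notin l).
Proof. by rewrite !inE. Qed.

Lemma nbsP P q : reflect (exists2 u, u \in P & q \in nb u) (q \in nbs P).
Proof.
apply: (iffP flattenP) => [[_ /mapP[u uP ->] qu]|[u uP qu]]; first by exists u.
by exists (nb u) => //; apply: map_f.
Qed.

Lemma sub_nbs P q : q \in P -> q \in nbs P.
Proof. by move=> qP; apply/nbsP; exists q. Qed.

Lemma gclosedU_remseq P B E : B `<=` remseq E (nbs P) -> gclosed P (P `|` B).
Proof.
move=> /fsubsetP BE; apply/gclosedP => u v uP vu; rewrite inE => /orP[//|/BE].
by rewrite in_remseq => /andP[_ /nbsP[]]; exists u.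
Qed.

Lemma disjoint_remseq P B E : B `<=` remseq E (nbs P) -> forall q, q \in P -> q \notin B.
Proof.
move=> /fsubsetP BE q qP; apply: contraTN qP => /BE; rewrite in_remseq => /andP[_].
by apply: contraNN => /sub_nbs.
Qed.

(** A set containing [p] is the same as the component [P] of [p] together with a remainder that
    avoids all neighbours of [P]; the inverse map is [component p]. *)
Lemma sum_component (V : nmodType) p E (F : {fset K} -> V) :
  \sum_(B <- fpowerset E | p \in B) F B =
  \sum_(P <- fpowerset E | conn p P) \sum_(B <- fpowerset (remseq E (nbs P))) F (P `|` B).
Proof.
rewrite -big_filter -[RHS]big_filter.
rewrite -(big_allpairs_dep (h := pair) (F := fun x => F (x.1 `|` x.2))) /=.
have inj : {in [seq (P, B) | P <- [seq P <- fpowerset E | conn p P],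
    B <- fpowerset (remseq E (nbs P))] &, injective (fun x => x.1 `|` x.2)}.
  have H : forall x, x \in [seq (P, B) | P <- [seq P <- fpowerset E | conn p P],
       B <- fpowerset (remseq E (nbs P))] ->
       component p (x.1 `|` x.2) = x.1 /\ x.2 = (x.1 `|` x.2) `\` x.1.
    move=> x /allpairsPdep[P [B [/[!mem_filter]/andP[cP PE]]]].
    rewrite fpowersetE => BE -> /=; split.
      apply: component_unique; rewrite ?fsubsetUl //; exact: gclosedU_remseq BE.
    apply/fsetP => q; rewrite !inE; have := disjoint_remseq BE (q := q).
    by case: (q \in P) => // /(_ isT)/negPf.
  move=> x y /H[c1 e1] /H[c2 e2] e; rewrite [x]surjective_pairing [y]surjective_pairing.
  have e' : x.1 = y.1 by rewrite -c1 -c2 e.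
  by congr pair => //; rewrite e1 e2 e e'.
apply: (sum_reindex_seq (h := fun x => x.1 `|` x.2)) => //.
- apply: allpairs_uniq_dep => [|P _|[P B] [P' B'] _ _ /= [-> ->] //].
    exact/filter_uniq/fset_uniq.
  exact: fset_uniq.
- exact/filter_uniq/fset_uniq.
move=> B; rewrite mem_filter fpowersetE; apply/idP/mapP.
  case/andP => pB BE; exists (component p B, B `\` component p B) => /=; last first.
    apply/fsetP => q; rewrite in_fsetU in_fsetD.
    by case: (boolP (q \in component p B)) => //= /(fsubsetP (component_sub p B)).
  apply/allpairsPdep; exists (component p B), (B `\` component p B); split=> //.
    rewrite mem_filter conn_component //= fpowersetE.
    exact: fsubset_trans (component_sub _ _) BE.
  rewrite fpowersetE; apply/fsubsetP => q; rewrite in_remseq in_fsetD => /andP[qC qB].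
  rewrite (fsubsetP BE) //=; apply: contraNN qC => /nbsP[u uC qu].
  exact: (gclosedP _ _ (gclosed_component p B) u q uC qu qB).
case=> x /allpairsPdep[P [B' [/[!mem_filter]/andP[/andP[pP _]]]]].
rewrite !fpowersetE => PE BE -> -> /=; rewrite inE pP /= fsubUset PE.
apply: fsubset_trans BE _; apply/fsubsetP => q; rewrite in_remseq; by case/andP.
Qed.

(** A value of [h] skipped below [h q] would cut [C] in two, since [h] rises by at most one along an
    edge. So [h] takes on [C] all values from 0 to [h q]. *)
Lemma conn_card p C q (h : K -> nat) : conn p C -> q \in C ->
  h p = 0%N -> (forall u v, v \in nb u -> (h v <= (h u).+1)%N) -> (h q < #|` C|)%N.
Proof.
move=> cC qC hp hL; have pC : p \in C by case/andP: cC.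
have lev n : (n <= h q)%N -> n \in [seq h z | z <- C].
  move=> nq; apply/negPn/negP => /mapP H.
  have n0 : (0 < n)%N by case: n nq H => // _ []; exists p.
  pose U := [fset z in C | (h z < n)%N].
  have UC : U = C.
    move/connP: cC => /(_ pC); apply.
    - by apply/fsubsetP => z; rewrite !inE => /andP[].
    - by rewrite !inE pC hp.
    apply/gclosedP => u v; rewrite !inE => /andP[uC un] vu vC; rewrite vC /=.
    rewrite ltn_neqAle (leq_trans (hL _ _ vu)) // andbT.
    by apply/eqP => e; apply: H; exists v.
  by have := qC; rewrite -UC !inE ltnNge nq andbF.
rewrite -(size_map h) -[X in (X <= _)%N](size_iota 0); apply: uniq_leq_size.
  exact: iota_uniq.
by move=> n; rewrite mem_iota add0n ltnS /=; apply: lev.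
Qed.

(** * Generating functions of connected sets *)

Section Trees.
Variables (R : realType) (D : nat) (y t : R).
Hypothesis nb_size : forall p, (size (nb p) <= D)%N.
Hypotheses (y0 : 0 <= y) (t0 : 0 <= t) (yt : y * (1 + t) ^+ D <= t).

(** Each root in [l] is either absent, for a factor 1, or contributes its component, for a factor
    [t]; what is left is rooted in the rest of the list. *)
Lemma rooted_sum_le E l :
  (forall q, \sum_(P <- fpowerset E | conn q P) y ^+ #|` P| <= t) ->
  \sum_(P <- fpowerset E | rooted l P) y ^+ #|` P| <= (1 + t) ^+ size l.
Proof.
move=> HT; elim: l => [|q l IH] /=.
  apply: (@le_trans _ _ (\sum_(P <- fpowerset E) (if fset0 == P then 1 else 0 : R))).
    rewrite big_mkcond; apply: ler_sum => P _; case: ifP => [/rootedP H|_].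
      have e : fset0 = P by apply: H.
      by rewrite -e eqxx cardfs0 expr0.
    by case: ifP.
  by rewrite sum_if_eq ?fset_uniq // expr0; case: ifP.
rewrite (bigID (fun P => q \in P)) /= addrC exprS mulrDl mul1r; apply: lerD.
  apply: le_trans IH; rewrite big_mkcond [leRHS]big_mkcond /=.
  apply: ler_sum => P _; case: ifP => [/andP[/rootedP H qP]|_]; last first.
    by case: ifP; rewrite ?exprn_ge0.
  case: ifP => // /rootedP[]; move=> U UP lU; apply: H => // z; rewrite inE.
  by case/orP => [/eqP ->|/lU //]; rewrite (negPf qP).
pose F B : R := if rooted (q :: l) B then y ^+ #|` B| else 0.
rewrite (eq_bigl (fun P => (q \in P) && rooted (q :: l) P)); last by move=> P; rewrite andbC.
rewrite big_mkcondr -/F sum_component.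
apply: (@le_trans _ _ (\sum_(P <- fpowerset E | conn q P)
    y ^+ #|` P| * \sum_(B <- fpowerset E | rooted l B) y ^+ #|` B|)); last first.
  rewrite -big_distrl /= ler_pM // ?HT //.
    by apply: sumr_ge0 => P _; rewrite exprn_ge0.
  by apply: sumr_ge0 => P _; rewrite exprn_ge0.
apply: ler_sum => P cP; have qP : q \in P by case/andP: cP.
rewrite big_distrr /= big_mkcond /= [leRHS]big_mkcond /=.
apply: (@le_trans _ _ (\sum_(B <- fpowerset (remseq E (nbs P)))
    if rooted l B then y ^+ #|` P| * y ^+ #|` B| else 0)); last first.
  apply: (ler_sum_inj_seq (h := id)) => //.
    move=> B; rewrite !fpowersetE => /fsubset_trans; apply.
    by apply/fsubsetP => z; rewrite in_remseq => /andP[].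
  by move=> B _; case: ifP; rewrite ?mulr_ge0 ?exprn_ge0.
rewrite big_seq [leRHS]big_seq; apply: ler_sum => B; rewrite fpowersetE => BE.
have dis := disjoint_remseq BE.
rewrite /F; case: ifP => [/rootedP H|_]; last by case: ifP; rewrite ?mulr_ge0 ?exprn_ge0.
have card : #|` P `|` B| = (#|` P| + #|` B|)%N.
  rewrite -cardfsUI; have -> : P `&` B = fset0; last by rewrite cardfs0 addn0.
  by apply/fsetP => z; rewrite !inE; apply/andP => -[/dis/negPf ->].
rewrite card exprD; case: ifP => // /rootedP[]; move=> U UB lU cU.
have e : P `|` U = P `|` B.
  apply: H; first exact: fsetUS.
    move=> z; rewrite !inE => /orP[/eqP ->|zl]; first by rewrite qP.
    by case/orP => [->//|zB]; rewrite lU ?orbT.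
  apply/gclosedP => u v; rewrite !inE => /orP[uP|uU] vu.
    by move=> vPB; have := gclosedP _ _ (gclosedU_remseq BE) u v uP vu;
      rewrite inE => -> //.
  by case/orP => [->//|vB]; rewrite (gclosedP _ _ cU u v) ?orbT.
apply/eqP; rewrite eqEfsubset UB; apply/fsubsetP => z zB.
have := congr1 (fun X : {fset K} => z \in X) e; rewrite !inE zB orbT.
by case/orP => // /dis; rewrite zB.
Qed.

(* Removing its root splits a connected set into connected sets rooted at
   neighbours of the root. *)
Lemma conn_sum_le E p : \sum_(P <- fpowerset E | conn p P) y ^+ #|` P| <= t.
Proof.
have [n] := ubnP #|` E|; elim: n => // n IH in E p *; rewrite ltnS => En.
case: (boolP (p \in E)) => pE; last first.
  rewrite big_seq_cond big1 // => P; rewrite fpowersetE => /andP[/fsubsetP PE /andP[/PE]].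
  by rewrite (negPf pE).
(* The recursion closes here: weight [y] for the root and at most [1 + t] for each of its at most
   [D] neighbours. *)
apply: le_trans yt.
have E'n : (#|` E `\ p| < n)%N.
  by apply: leq_trans En; rewrite (cardfsD1 p E) pE add1n.
apply: (@le_trans _ _ (y * \sum_(P <- fpowerset (E `\ p) | rooted (nb p) P) y ^+ #|` P|)).
  rewrite big_distrr /= -big_filter -[leRHS]big_filter.
  rewrite big_seq (eq_bigr (fun P => y * y ^+ #|` P `\ p|)); last first.
    move=> P; rewrite mem_filter => /andP[/andP[pP _] _].
    by rewrite (cardfsD1 p P) pP exprS.
  rewrite -big_seq; apply: (ler_sum_inj_seq (h := fun P => P `\ p)).
  - exact/filter_uniq/fset_uniq.
  - exact/filter_uniq/fset_uniq.
  - move=> P Q; rewrite !mem_filter => /andP[/andP[pP _] _] /andP[/andP[pQ _] _] e.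
    by rewrite -(fsetD1K pP) e fsetD1K.
  - move=> P; rewrite !mem_filter !fpowersetE => /andP[cP PE].
    rewrite fsetSD // andbT; apply/rootedP => U UP lU cU.
    have pP : p \in P by case/andP: cP.
    have e : p |` U = P.
      move/connP: cP => /(_ pP); apply.
      + by rewrite fsubUset fsub1set pP (fsubset_trans UP) // fsubD1set.
      + by rewrite !inE eqxx.
      apply/gclosedP => u v; rewrite !inE; case: (eqVneq v p) => //= vp.
      case/orP => [/eqP ->|uU] vu vP; first by apply: lU => //; rewrite !inE vp.
      by apply: (gclosedP _ _ cU u v uU vu); rewrite !inE vp.
    rewrite -e; apply/fsetP => z; rewrite !inE.
    case: eqVneq => //= ->; apply/negbTE; apply: contraTN isT => /(fsubsetP UP).
    by rewrite !inE eqxx.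
  - by move=> P _; rewrite mulr_ge0 ?exprn_ge0.
rewrite ler_wpM2l //; apply: le_trans (rooted_sum_le _ _) _; first by move=> q; apply: IH.
by rewrite ler_weXn2l // lerDl.
Qed.

End Trees.
End Components.

(** * Polymer gases *)

Definition psum (R : realType) (K : choiceType) (w : {fset K} -> R) (A : {fset K}) : R :=
  \sum_(B <- fpowerset A) w B.

(** Weights belong to whole configurations, and [pwM] makes them products over separated pieces.
    They may be negative or zero, so that a Wilson loop can be absorbed into them. *)
Record polymer_weight (R : realType) (K : choiceType) (nb : K -> seq K) (x : R)
    (w : {fset K} -> R) : Prop := PolymerWeight {
  pw0 : w fset0 = 1;
  pwM : forall P Q, (forall u v, u \in P -> v \in Q -> v \notin nb u) ->
    w (P `|` Q) = w P * w Q;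
  pw_le : forall B, `|w B| <= x ^+ #|` B| }.

Section Polymers.
Variables (R : realType) (K : choiceType) (nb : K -> seq K) (D : nat) (x s t : R).
Hypotheses (nb_refl : forall p, p \in nb p) (nb_size : forall p, (size (nb p) <= D)%N).
Hypotheses (x0 : 0 <= x) (s1 : 1 <= s) (t0 : 0 <= t) (t1 : t < 1).
(** The convergence condition: each point of a polymer removes at most [D] neighbours, at the price
    of a ratio bounded by [(1 - t)^-1] each, and counting connected sets costs [1 + t] per
    neighbour. *)
Hypothesis xst : x * s * ((1 + t) / (1 - t)) ^+ D <= t.
Variable w : {fset K} -> R.
Hypothesis pw : polymer_weight nb x w.
Implicit Types (A B C E P U : {fset K}) (p q : K) (l : seq K).

Let Z := psum w.
Let a := (1 - t)^-1.
Let y := x * s * a ^+ D.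

Let s0 : 0 <= s. Proof. exact: le_trans s1. Qed.
Let t1' : 0 < 1 - t. Proof. by rewrite subr_gt0. Qed.
Let a1 : 1 <= a. Proof. by rewrite invf_ge1 // gerBl. Qed.
Let a0 : 0 <= a. Proof. exact: le_trans a1. Qed.
Let y0 : 0 <= y. Proof. by rewrite !mulr_ge0 ?exprn_ge0. Qed.

Let yt : y * (1 + t) ^+ D <= t.
Proof. by rewrite /y -!mulrA -exprMn mulrA [a * _]mulrC. Qed.

Lemma psum0 : Z fset0 = 1.
Proof. by rewrite /Z /psum sum_fpowerset0 (pw0 pw). Qed.

Lemma psum_component p E : p \in E ->
  Z E = Z (E `\ p) +
    \sum_(P <- fpowerset E | conn nb p P) w P * Z (remseq E (nbs nb P)).
Proof.
move=> pE; rewrite /Z /psum (bigID (fun B => p \in B)) /= addrC; congr (_ + _).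
  rewrite -big_filter; apply: perm_big; apply: uniq_perm; rewrite ?filter_uniq ?fset_uniq //.
  move=> B; rewrite mem_filter !fpowersetE; apply/andP/idP => [[pB BE]|/fsubsetP BE].
    apply/fsubsetP => z zB; rewrite !inE (fsubsetP BE) // andbT.
    by apply: contraNneq pB => <-.
  split; first by apply/negP => /BE; rewrite !inE eqxx.
  by apply/fsubsetP => z /BE; rewrite !inE => /andP[].
rewrite (sum_component nb_refl); apply: eq_bigr => P _; rewrite big_distrr /=.
rewrite big_seq [RHS]big_seq; apply: eq_bigr => B; rewrite fpowersetE => /fsubsetP BE.
apply: (pwM pw) => u v uP /BE; rewrite in_remseq => /andP[_]; apply: contraNN => vu.
by apply/nbsP; exists u.
Qed.

Let ratio p E A := mnorm s A (fun B => Z (B `&` (E `\ p)) / Z (B `&` E)).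
(** Positivity and the ratio bound are proved together, by induction on the cardinal of [E]: the
    ratios make sense only once the denominators are nonzero. Everything is a function of [B], since
    the norm is taken in that variable. *)
Let good E := (forall B, 0 < Z (B `&` E)) /\ (forall p A, p \in E -> ratio p E A <= a).

(** Telescoping product of ratios that remove one point each; a member of [l] outside [E] costs
    nothing, and [1 <= a] absorbs it. *)
Lemma ratio_remseq E l A : (forall E', E' `<=` E -> good E') ->
  mnorm s A (fun B => Z (B `&` remseq E l) / Z (B `&` E)) <= a ^+ size l.
Proof.
elim: l E => [|q l IH] E gE /=.
  rewrite (eq_mnorm _ (h := fun=> 1)) => [|B _]; last first.
    have -> : remseq E [::] = E by apply/fsetP => z; rewrite in_remseq andbT.
    by rewrite divff // gt_eqF //; case: (gE E (fsubset_refl _)).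
  by rewrite (le_trans (mnorm_cst _ _ _)) // normr1.
have eE : remseq E (q :: l) = remseq (E `\ q) l.
  by apply/fsetP => z; rewrite !in_remseq !inE negb_or; case: (z == q); case: (z \in E).
rewrite eE; have gE' E' : E' `<=` E `\ q -> good E'.
  by move=> h; apply: gE; apply: fsubset_trans h (fsubD1set _ _).
case: (boolP (q \in E)) => qE; last first.
  have -> : E `\ q = E by apply/fsetP => z; rewrite !inE; case: eqVneq => //= ->; rewrite (negPf qE).
  by apply: le_trans (IH _ gE) _; rewrite ler_weXn2l.
rewrite (eq_mnorm _ (h := fun B => (Z (B `&` (E `\ q)) / Z (B `&` E)) *
   (Z (B `&` remseq (E `\ q) l) / Z (B `&` (E `\ q))))) => [|B _]; last first.
  have [h1 _] := gE _ (fsubD1set E q); have [h2 _] := gE _ (fsubset_refl E).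
  by field; rewrite !gt_eqF.
apply: le_trans (mnormM s1 _ _ _) _; rewrite exprS ler_pM ?mnorm_ge0 //.
  by have [_] := gE _ (fsubset_refl E); apply.
exact: IH.
Qed.

(* [1 + du p E B] is the ratio of the partition functions of [B `&` E] and
   [B `&` (E `\ p)], expanded over the component of [p]. *)
Let du p E B := \sum_(P <- fpowerset E | conn nb p P)
  w P * ((P `<=` B)%:R * (Z (B `&` remseq (E `\ p) (nbs nb P)) / Z (B `&` (E `\ p)))).

Lemma size_nbs P : (size (nbs nb P) <= D * #|` P|)%N.
Proof.
rewrite /nbs; elim: (enum_fset P) => //= p l IH.
by rewrite size_cat mulnS leq_add.
Qed.

(** A component with [n] points contributes [x ^+ n] from its weight, [s ^+ n] from the indicator
    and [a ^+ (D * n)] from the removed neighbours, that is [y ^+ n]; [conn_sum_le] sums these. *)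
Lemma mnorm_du p E A : p \in E -> (forall E', E' `<=` E `\ p -> good E') ->
  mnorm s A (du p E) <= t.
Proof.
move=> pE gE; apply: le_trans (conn_sum_le nb_refl nb_size y0 t0 yt E p).
rewrite /du -big_filter.
rewrite (eq_mnorm _ (h := fun B => \sum_(P <- [seq P <- fpowerset E | conn nb p P])
  w P * ((P `<=` B)%:R * (Z (B `&` remseq (E `\ p) (nbs nb P)) / Z (B `&` (E `\ p)))))); last first.
  by move=> B _; rewrite big_filter.
apply: le_trans (mnorm_sum s1 _ _ _) _; apply: ler_sum => P _.
rewrite mnormZ // /y !exprMn -mulrA ler_pM ?mnorm_ge0 ?(pw_le pw) //.
apply: le_trans (mnormM s1 _ _ _) _; rewrite ler_pM ?mnorm_ge0 //.
  exact: mnorm_ind.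
apply: le_trans (ratio_remseq _ _ gE) _.
by rewrite -exprM ler_weXn2l // size_nbs.
Qed.

Lemma psum_du p E B : p \in E -> 0 < Z (B `&` (E `\ p)) ->
  Z (B `&` E) = Z (B `&` (E `\ p)) * (1 + du p E B).
Proof.
move=> pE z0; rewrite mulrDr mulr1 /du big_distrr /=.
rewrite (eq_bigr (fun P => if P `<=` B then
   w P * Z (B `&` remseq (E `\ p) (nbs nb P)) else 0)); last first.
  move=> P _; case: (P `<=` B); rewrite /= ?mul0r ?mulr0 // mul1r mulrCA.
  by congr (_ * _); rewrite mulrC divfK // gt_eqF.
rewrite -big_mkcondr; case: (boolP (p \in B)) => pB; last first.
  rewrite big1 ?addr0 => [|P /andP[/andP[pP _] /fsubsetP/(_ _ pP)]]; last by rewrite (negPf pB).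
  congr Z; apply/fsetP => z; rewrite !inE; case: eqVneq => //= ->.
  by rewrite (negPf pB).
have pBE : p \in B `&` E by rewrite inE pB.
rewrite (psum_component pBE); congr (_ + _).
  by congr Z; apply/fsetP => z; rewrite !inE andbCA.
rewrite -[LHS]big_filter -[RHS]big_filter.
rewrite (perm_big [seq P <- fpowerset E | conn nb p P & P `<=` B]) /=; last first.
  apply: uniq_perm; rewrite ?filter_uniq ?fset_uniq // => P.
  by rewrite !mem_filter !fpowersetE fsubsetI /= andbA.
rewrite big_seq [RHS]big_seq; apply: eq_bigr => P.
rewrite mem_filter => /andP[/andP[/andP[pP _] _] _]; congr (_ * Z _).
apply/fsetP => z; rewrite in_remseq !in_fsetI in_remseq in_fsetD1.
by case: (eqVneq z p) => [->|]; rewrite ?(sub_nbs nb_refl pP) ?andbF //= andbA.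
Qed.

(** The norm of [du] is at most [t < 1], so [1 + du] is positive and its inverse has norm at most
    [a]: the bound assumed for smaller sets reproduces itself. *)
Lemma polymer_good E : good E.
Proof.
have [n] := ubnP #|` E|; elim: n => // n IH in E *; rewrite ltnS => En.
have IH' p : p \in E -> forall E', E' `<=` E `\ p -> good E'.
  move=> pE E' h; apply: IH; apply: leq_ltn_trans (fsubset_leq_card h) _.
  by apply: leq_trans En; rewrite (cardfsD1 p E) pE add1n.
have pos p B : p \in E -> 0 < 1 + du p E B.
  move=> pE; have := ler_mnorm s1 (du p E) (fsubset_refl B).
  move/le_trans/(_ (mnorm_du B pE (IH' _ pE))); rewrite ler_norml => /andP[h _].
  by move: t1; lra.
have zpos p B : p \in E -> 0 < Z (B `&` (E `\ p)).
  by move=> pE; have [] := IH' _ pE _ (fsubset_refl _).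
split=> [B|p A pE].
  have [->|[p pE]] := fset_0Vmem E; first by rewrite fsetI0 psum0.
  by rewrite (psum_du pE) ?zpos // mulr_gt0 ?zpos ?pos.
rewrite /ratio (eq_mnorm _ (h := fun B => (1 + du p E B)^-1)) => [|B _]; last first.
  by rewrite (psum_du pE) ?zpos // invfM mulrA divff ?mul1r // gt_eqF // zpos.
exact: mnorm_inv1D (mnorm_du _ pE (IH' _ pE)) t1.
Qed.

Lemma psum_gt0 A : 0 < Z A.
Proof. by have [/(_ A)] := polymer_good A; rewrite fsetIid. Qed.

(** The sum of all terms of the cluster expansion with support exactly [C], obtained by Moebius
    inversion instead of Ursell functions. *)
Definition cluster C : R := mob (fun B => ln (psum w B)) C.

Lemma ln_psum A : ln (Z A) = \sum_(C <- fpowerset A) cluster C.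
Proof. by rewrite (sum_mob (fun B => ln (psum w B))). Qed.

(** On sets [C] containing [p] the function [ln (Z (B without p))] has zero transform, so the
    cluster of [C] is also the transform of [ln (1 + du p A)], whose norm is under control. *)
Lemma cluster_sum_le A p :
  \sum_(C <- fpowerset A | p \in C) `|cluster C| * s ^+ #|` C| <= t / (1 - t).
Proof.
case: (boolP (p \in A)) => pA; last first.
  rewrite big_seq_cond big1 ?divr_ge0 ?(ltW t1') // => C.
  by rewrite fpowersetE => /andP[/fsubsetP CA /CA]; rewrite (negPf pA).
apply: le_trans (mnorm_ln1D s1 (mnorm_du A pA (fun E' _ => polymer_good E')) t1).
rewrite /mnorm big_mkcond /= big_seq [leRHS]big_seq; apply: ler_sum => C.
rewrite fpowersetE => CA; case: ifP => pC; last by rewrite mulr_ge0 ?exprn_ge0.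
rewrite ler_wpM2r ?exprn_ge0 // le_eqVlt; apply/orP; left; apply/eqP; congr `|_|.
rewrite (eq_mob (h := fun B => ln (Z B) + (-1) * ln (Z (B `\ p)))) => [|B BC].
  rewrite mobD mobZ [X in _ + _ * X](mob_indep (p := p)) ?mulr0 ?addr0 // => B _.
  by congr (ln (Z _)); apply/fsetP => z; rewrite !inE; case: (z == p).
have BA : B `&` A = B by apply/fsetIidPl; apply: fsubset_trans BC CA.
have := psum_du (B := B) pA; have [/(_ B) h _] := polymer_good (A `\ p).
have eBp : B `&` (A `\ p) = B `\ p by rewrite fsetIDA BA.
rewrite eBp in h *; rewrite BA => /(_ h) e.
have d0 : 0 < 1 + du p A B by move: (psum_gt0 B); rewrite e pmulr_rgt0.
by rewrite mulN1r e lnM ?posrE // addrAC subrr add0r.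
Qed.

Lemma psumU A B : (forall u v, u \in A -> v \in B -> v \notin nb u) ->
  Z (A `|` B) = Z A * Z B.
Proof.
move=> dAB; rewrite /Z /psum big_distrlr /=.
have dis z : z \in A -> z \notin B.
  by move=> zA; apply/negP => zB; have := dAB z z zA zB; rewrite nb_refl.
rewrite -(big_allpairs_dep (h := pair) (F := fun x => w x.1 * w x.2)) /=.
rewrite (sum_reindex_seq (s := [seq (X, Y) | X <- fpowerset A, Y <- fpowerset B])
   (h := fun x => x.1 `|` x.2)).
- rewrite big_seq [RHS]big_seq; apply: eq_bigr => z /allpairsP[[X Y] /=].
  rewrite !fpowersetE => -[XA YB ->] /=; apply: (pwM pw) => u v uX vY.
  by apply: dAB; [apply: (fsubsetP XA)|apply: (fsubsetP YB)].
- by apply: allpairs_uniq; rewrite ?fset_uniq // => -[? ?] [? ?] _ _ [-> ->].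
- exact: fset_uniq.
- have H : forall z, z \in [seq (X, Y) | X <- fpowerset A, Y <- fpowerset B] ->
      z.1 = (z.1 `|` z.2) `&` A /\ z.2 = (z.1 `|` z.2) `&` B.
    move=> z /allpairsP[[X Y] /=]; rewrite !fpowersetE => -[/fsubsetP XA /fsubsetP YB ->] /=.
    split; apply/fsetP => k; rewrite !inE; have := XA k; have := YB k; have := dis k;
    by case: (k \in X); case: (k \in Y); case: (k \in A); case: (k \in B) => //= h1 h2 h3;
      by [have := h1 isT|have := h2 isT|have := h3 isT].
  move=> z z' /H[e1 e2] /H[e1' e2'] e; rewrite [z]surjective_pairing [z']surjective_pairing.
  by congr pair; [rewrite e1 e1' e|rewrite e2 e2' e].
move=> C; rewrite fpowersetE; apply/idP/mapP => [CAB|[z /allpairsP[[X Y] /=]]].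
  exists (C `&` A, C `&` B) => /=; last by rewrite -fsetIUr (fsetIidPl CAB).
  by apply/allpairsP; exists (C `&` A, C `&` B); rewrite !fpowersetE !fsubsetIr.
by rewrite !fpowersetE => -[XA YB -> ->] /=; apply: fsetUSS.
Qed.

(** If a closed part [U] contains [p] and misses [v], then [ln Z] splits into a function independent
    of [v] and one independent of [p]; both transforms vanish at [C]. *)
Lemma cluster_conn C p : p \in C -> cluster C != 0 -> conn nb p C.
Proof.
move=> pC c0; apply/connP => // U UC pU cU; apply/eqP; rewrite eqEfsubset UC.
apply/fsubsetP => v vC; apply: contraNT c0 => vU.
rewrite /cluster (eq_mob (h := fun B => ln (Z (B `&` U)) + ln (Z (B `\` U)))) => [|B BC].
  rewrite mobD (mob_indep (p := v)) ?(mob_indep (p := p)) ?addr0 // => B _; congr (ln (Z _)).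
    by apply/fsetP => z; rewrite !inE; case: eqVneq => // ->; rewrite pU.
  by apply/fsetP => z; rewrite !inE; case: eqVneq => // ->; rewrite (negPf vU) !andbF.
have zB : Z B = Z (B `&` U) * Z (B `\` U).
  rewrite -psumU ?fsetID // => u q; rewrite !inE => /andP[_ uU] /andP[qU qB].
  apply: contraNN qU => qu; apply: (gclosedP _ _ _ cU u q uU qu).
  by apply: (fsubsetP BC).
by rewrite -/(Z B) zB lnM ?posrE ?psum_gt0.
Qed.

End Polymers.

Lemma eq_cluster (R : realType) (K : choiceType) (w w' : {fset K} -> R) C :
  (forall B, B `<=` C -> w B = w' B) -> cluster w C = cluster w' C.
Proof.
move=> e; apply: eq_mob => B BC; congr ln.
rewrite /psum big_seq [RHS]big_seq; apply: eq_bigr => B'; rewrite fpowersetE => B'B.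
exact: e (fsubset_trans B'B BC).
Qed.

(** * Tail bounds for combinations of clusters *)

Section ClusterTail.
Variables (R : realType) (K : choiceType) (nb : K -> seq K) (D : nat) (x s t : R).
Hypotheses (nb_refl : forall p, p \in nb p) (nb_size : forall p, (size (nb p) <= D)%N).
Hypotheses (x0 : 0 <= x) (s1 : 1 <= s) (t0 : 0 <= t) (t1 : t < 1).
Hypothesis xst : x * s * ((1 + t) / (1 - t)) ^+ D <= t.

(** The pattern of all later estimates. [Psi] is a combination of clusters of several gases; once
    cancellations are taken into account, a surviving connected set meets [l] at some [p] and has at
    least [n p] points, which the weight [s] turns into decay. *)
Lemma cluster_tail (ws : seq ({fset K} -> R)) (A : {fset K}) (Psi : {fset K} -> R)
    (l : seq K) (n : K -> nat) :
  (forall C, `|Psi C| <= \sum_(w <- ws) `|cluster w C|) ->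
  List.Forall (polymer_weight nb x) ws ->
  (forall C, Psi C != 0 -> (forall q, q \in C -> conn nb q C) ->
     exists p, [/\ p \in l, p \in C & (n p <= #|` C|)%N]) ->
  `|\sum_(C <- fpowerset A) Psi C| <=
  (size ws)%:R * (t / (1 - t)) * \sum_(p <- l) s ^- n p.
Proof.
move=> Psile pws Psi0; have s0 : 0 < s by apply: lt_le_trans s1.
apply: le_trans (ler_norm_sum _ _ _) _.
(* Every set is charged to all members of [l] that it contains, an overcount that allows the sums to
   be exchanged. *)
apply: (@le_trans _ _ (\sum_(C <- fpowerset A) \sum_(p <- l)
    (if p \in C then (\sum_(w <- ws) `|cluster w C| * s ^+ #|` C|) * s ^- n p else 0))).
  apply: ler_sum => C _; case: (eqVneq (Psi C) 0) => [->|nz].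
    rewrite normr0; apply: sumr_ge0 => p _; case: ifP => // _.
    rewrite mulr_ge0 ?invr_ge0 ?exprn_ge0 ?(ltW s0) //.
    by apply: sumr_ge0 => w _; rewrite mulr_ge0 ?exprn_ge0 ?(ltW s0).
  have [p [pl pC np]] : exists p, [/\ p \in l, p \in C & (n p <= #|` C|)%N].
    apply: Psi0 => // q qC.
    have : \sum_(w <- ws) `|cluster w C| != 0.
      by rewrite gt_eqF //; apply: lt_le_trans (Psile C); rewrite normr_gt0.
    elim: ws pws {Psile} => [_|w ws IH H]; first by rewrite big_nil eqxx.
    have [hw hws] : polymer_weight nb x w /\ List.Forall (polymer_weight nb x) ws.
      by inversion H.
    rewrite big_cons; case: (eqVneq (cluster w C) 0) => [->|cw _].
      by rewrite normr0 add0r; apply: IH.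
    exact: (cluster_conn nb_refl nb_size x0 s1 t0 t1 xst hw qC cw).
  apply: (@le_trans _ _ ((\sum_(w <- ws) `|cluster w C| * s ^+ #|` C|) * s ^- n p)).
    rewrite -big_distrl /= -mulrA; apply: le_trans (Psile C) _.
    rewrite ler_peMr ?sumr_ge0 // ler_pdivlMr ?exprn_gt0 // mul1r.
    by rewrite ler_weXn2l.
  elim: l pl {Psi0} => [//|q l IH]; rewrite inE big_cons.
  have ge0 q' : 0 <= if q' \in C then
     (\sum_(w <- ws) `|cluster w C| * s ^+ #|` C|) * s ^- n q' else 0.
    case: ifP => // _; rewrite mulr_ge0 ?invr_ge0 ?exprn_ge0 ?(ltW s0) //.
    by apply: sumr_ge0 => w _; rewrite mulr_ge0 ?exprn_ge0 ?(ltW s0).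
  case/orP => [/eqP <-|/IH h]; first by rewrite pC lerDl sumr_ge0.
  by apply: le_trans h _; rewrite lerDr.
rewrite exchange_big /= big_distrr /=; apply: ler_sum => p _.
rewrite -big_mkcond -big_distrl /= ler_wpM2r ?invr_ge0 ?exprn_ge0 ?(ltW s0) //.
rewrite exchange_big /=.
elim: ws pws {Psile Psi0} => [_|w ws IH H]; first by rewrite big_nil mul0r.
have [hw hws] : polymer_weight nb x w /\ List.Forall (polymer_weight nb x) ws.
  by inversion H.
rewrite big_cons /= -natr1 mulrDl mul1r addrC lerD ?IH //.
exact: (cluster_sum_le nb_refl nb_size x0 s1 t0 t1 xst hw).
Qed.
End ClusterTail.

(** * Cells of the cubic lattice *)

Section Cells.
Variable m : nat.

Definition vert := {ffun 'I_m -> int}.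
(** Lowest corner and set of directions: the dimension is the cardinal of the second component, and
    a plaquette has a single name whatever the order of its directions. *)
Definition cell := (vert * {set 'I_m})%type.
Implicit Types (x y a : vert) (c p q : cell) (i j k l : 'I_m).

Definition ev k : vert := [ffun l => ((l == k) : nat)%:Z].

Lemma vaddE x y l : (x + y) l = x l + y l. Proof. by rewrite ffunE. Qed.
Lemma voppE x l : (- x) l = - x l. Proof. by rewrite ffunE. Qed.
Lemma evE k l : ev k l = ((l == k) : nat)%:Z. Proof. by rewrite ffunE. Qed.
Lemma evnE k n l : (ev k *+ n) l = ((l == k) * n)%N%:Z.
Proof. by rewrite ffunMnE evE -mulr_natr natz -PoszM. Qed.

Definition vertE := (vaddE, voppE, evnE, evE).

Definition faces c : seq cell :=
  [seq (c.1 + ev l *+ (b : bool), c.2 :\ l)%SET | l <- enum c.2, b <- [:: false; true]].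

Definition cofaces p : seq cell :=
  [seq (p.1 - ev k *+ (b : bool), (k |: p.2)%SET) | k <- enum (~: p.2)%SET, b <- [:: false; true]].

(* The plaquettes sharing a 3-cell with [p], [p] included.  Cells of dimension other
   than 2 never belong to an admissible set; [[:: p]] only serves reflexivity. *)
Definition nbr p : seq cell :=
  if #|p.2| == 2%N then flatten [seq faces c | c <- cofaces p] else [:: p].

Lemma faces_cofaces c q : q \in faces c -> c \in cofaces q.
Proof.
case: c => y E /allpairsP[[l b] /= [lE _ ->]]; apply/allpairsP; exists (l, b) => /=.
split; rewrite ?mem_enum ?inE ?eqxx //; first by case: b.
by rewrite addrK finset.setD1K // -mem_enum.
Qed.

Lemma card_face c q : #|c.2| = 3%N -> q \in faces c -> #|q.2| = 2%N.
Proof.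
case: c => y E /= E3 /allpairsP[[l b] /= [lE _ ->]] /=; rewrite mem_enum in lE.
by have := cardsD1 l E; rewrite E3 lE => -[].
Qed.

Lemma faces_nbr c p q : #|c.2| = 3%N -> p \in faces c -> q \in faces c -> q \in nbr p.
Proof.
move=> c3 pc qc; rewrite /nbr (card_face c3 pc) eqxx; apply/flattenP.
by exists (faces c) => //; apply: map_f; apply: faces_cofaces.
Qed.

Lemma card_coface p c : #|p.2| = 2%N -> c \in cofaces p -> #|c.2| = 3%N.
Proof.
move=> p2 /allpairsP[[k b] /= [kp _ ->]] /=; rewrite mem_enum inE in kp.
by rewrite cardsU1 kp p2.
Qed.

Lemma nbrP p q : q \in nbr p -> q = p \/ exists k l (b b' : bool),
  q.1 = p.1 - ev k *+ b + ev l *+ b'.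
Proof.
rewrite /nbr; case: ifP => _; last by rewrite inE => /eqP; left.
move=> /flattenP[_ /mapP[c /allpairsP[[k b] /= [_ _ ->]] ->]].
by move=> /allpairsP[[l b'] /= [_ _ ->]]; right; exists k, l, b, b'.
Qed.

(** A plaquette lies in [2 (m - 2)] three-cells, with six faces each. *)
Lemma size_nbr p : (2 < m)%N -> (size (nbr p) <= 12 * (m - 2))%N.
Proof.
move=> m3; rewrite /nbr; case: ifP => [/eqP p2|_] /=; last by lia.
have -> : size (flatten [seq faces c | c <- cofaces p]) = (6 * size (cofaces p))%N.
  have : {in cofaces p, forall c, #|c.2| = 3%N} by move=> c; apply: card_coface.
  elim: (cofaces p) => //= c cs IH H; rewrite size_cat IH => [|c' c'cs]; last first.
    by apply: H; rewrite inE c'cs orbT.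
  by rewrite size_allpairs -cardE H ?mem_head // mulnS.
rewrite size_allpairs -cardE cardsCs finset.setCK p2 card_ord /=; lia.
Qed.

Lemma nbr_refl p : (2 < m)%N -> p \in nbr p.
Proof.
move=> m3; rewrite /nbr; case: ifP => [/eqP p2|_]; last exact: mem_head.
have /card_gt0P[k kp] : (0 < #|~: p.2|)%N.
  have := cardsC p.2; rewrite p2 card_ord; lia.
have cp : (p.1 - ev k *+ false, (k |: p.2)%SET) \in cofaces p.
  by apply/allpairsP; exists (k, false); rewrite mem_enum kp.
apply/flattenP; exists (faces (p.1 - ev k *+ false, (k |: p.2)%SET)); first exact: map_f.
apply/allpairsP; exists (k, false) => /=; rewrite mem_enum !inE eqxx; split=> //.
rewrite subrK; case: p kp {p2 cp} => y E /=; rewrite inE => kE.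
by rewrite finset.setU1K.
Qed.

Lemma nbr_lipschitz (a : int) k p q : q \in nbr p ->
  (`|q.1 k - a| <= `|p.1 k - a|.+1)%N.
Proof.
by case/nbrP => [-> //|[k' [l [b [b' ->]]]]]; rewrite !vertE; case: b; case: b';
  case: (k == k'); case: (k == l); lia.
Qed.

Lemma conn_dist p q (C : {fset cell}) k : conn nbr p C -> q \in C ->
  (`|q.1 k - p.1 k| < #|` C|)%N.
Proof.
move=> cC qC; apply: (@conn_card _ _ p C q (fun z : cell => `|z.1 k - p.1 k|%N) cC qC).
  by rewrite subrr.
by move=> u v; apply: nbr_lipschitz.
Qed.

(** The coboundary with coefficients in Z_2, where no incidence signs are needed. *)
Definition dcell (f : cell -> bool) c : bool :=
  \big[addb/false]_(l in c.2) (f (c.1, c.2 :\ l)%SET (+) f (c.1 + ev l, c.2 :\ l)%SET).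

Lemma dcell_faces f c : {in faces c, forall q, ~~ f q} -> dcell f c = false.
Proof.
move=> H; rewrite /dcell big1 // => l lc.
have mf (b : bool) : (c.1 + ev l *+ b, c.2 :\ l)%SET \in faces c.
  by apply/allpairsP; exists (l, b); rewrite mem_enum lc; split=> //; case: b.
have := H _ (mf false); have := H _ (mf true); rewrite mulr0n addr0 mulr1n.
by move=> /negPf -> /negPf ->.
Qed.

Lemma dcell3 f y i j k : i != j -> i != k -> j != k ->
  dcell f (y, [set i; j; k]%SET) =
  (f (y, [set j; k]%SET) (+) f (y + ev i, [set j; k]%SET)) (+)
  ((f (y, [set i; k]%SET) (+) f (y + ev j, [set i; k]%SET)) (+)
   (f (y, [set i; j]%SET) (+) f (y + ev k, [set i; j]%SET))).
Proof.
move=> ij ik jk; have ji : j != i by rewrite eq_sym.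
have ki : k != i by rewrite eq_sym. have kj : k != j by rewrite eq_sym.
rewrite /dcell /= -finset.setUA big_setU1 ?inE ?negb_or ?ij //=.
rewrite big_setU1 ?inE //= big_set1.
have e1 : ((i |: [set j; k]) :\ i = [set j; k])%SET.
  by rewrite finset.setU1K // !inE negb_or ij.
have e2 : ((i |: [set j; k]) :\ j = [set i; k])%SET.
  apply/setP => z; rewrite !inE; case: (eqVneq z j) => [->|] //=.
  by rewrite (negPf ji) (negPf jk).
have e3 : ((i |: [set j; k]) :\ k = [set i; j])%SET.
  apply/setP => z; rewrite !inE; case: (eqVneq z k) => [->|] //=.
    by rewrite (negPf ki) (negPf kj).
  by rewrite orbF.
by rewrite e1 e2 e3.
Qed.

End Cells.

(** * Closed sets of plaquettes as a polymer gas *)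

Section Weights.
Variables (R : realType) (m : nat) (x : R).
Hypotheses (m3 : (2 < m)%N) (x0 : 0 <= x).
Local Notation cell := (cell m).
Implicit Types (Lam : pred cell) (om B C A : {fset cell}) (l : seq cell).

Definition admissible Lam om : bool :=
  all (fun p : cell => (#|p.2| == 2%N) && Lam p) om &&
  `[< forall c : cell, #|c.2| = 3%N -> Lam c -> dcell (mem om) c = false >].

Lemma admissibleP Lam om :
  reflect ((forall p : cell, p \in om -> #|p.2| = 2%N /\ Lam p) /\
           (forall c : cell, #|c.2| = 3%N -> Lam c -> dcell (mem om) c = false))
          (admissible Lam om).
Proof.
apply: (iffP andP) => -[H1 H2]; split.
- by move=> p /(allP H1)/andP[/eqP].
- exact/asboolP.
- by apply/allP => p /H1[-> ->].
- exact/asboolP.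
Qed.

Definition sgp (b : bool) : R := if b then -1 else 1.
Definition sgn l om : R := \prod_(p <- l) sgp (p \in om).

(* Gibbs weight of the curvature [om] on the region [Lam] with free boundary
   condition (closedness is only required on the 3-cells of [Lam]), times the Wilson
   loop bounding the surface listed by [l]. *)
Definition wt Lam l om : R := if admissible Lam om then x ^+ #|` om| * sgn l om else 0.

Lemma sgpM b b' : sgp (b (+) b') = sgp b * sgp b'.
Proof. by case: b; case: b'; rewrite /sgp /= ?mulN1r ?opprK ?mul1r. Qed.

Lemma sgp_sqr b : sgp b * sgp b = 1.
Proof. by rewrite -sgpM addbb. Qed.

Lemma norm_sgn l om : `|sgn l om| = 1.
Proof.
rewrite /sgn normr_prod big1 // => p _.
by case: (_ \in _); rewrite /sgp ?normrN normr1.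
Qed.

Lemma sgn_disjoint l om : {in l, forall p, p \notin om} -> sgn l om = 1.
Proof. by move=> H; rewrite /sgn big_seq big1 // => p /H/negPf ->. Qed.

(** A 3-cell with a face in each of [P] and [Q] would make these faces neighbours. So closedness is
    checked separately on both parts, and the signs multiply. *)
Lemma polymer_wt Lam l : polymer_weight (@nbr m) x (wt Lam l).
Proof.
split.
- rewrite /wt; have -> : admissible Lam fset0.
    by apply/admissibleP; split=> [p //|c _ _]; apply: dcell_faces.
  by rewrite cardfs0 expr0 mul1r sgn_disjoint.
- move=> P Q nPQ.
  have dis z : z \in P -> z \notin Q.
    by move=> zP; apply/negP => zQ; have := nPQ z z zP zQ; rewrite nbr_refl.
  have inU z : (z \in P `|` Q) = (z \in P) (+) (z \in Q).
    rewrite inE; have := dis z; case: (z \in P) => //= /(_ isT)/negPf -> //.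
  have adm : admissible Lam (P `|` Q) = admissible Lam P && admissible Lam Q.
    have dU c : dcell (mem (P `|` Q)) c = dcell (mem P) c (+) dcell (mem Q) c.
      rewrite /dcell -big_split /=; apply: eq_bigr => k _.
      by rewrite ![_ \in mem (P `|` Q)]inU addbACA.
    apply/admissibleP/andP.
      case=> H1 H2; split; apply/admissibleP; split.
      + by move=> p pP; apply: H1; rewrite inE pP.
      + move=> c c3 Lc; have := H2 c c3 Lc; rewrite dU.
        case: (boolP (all (fun q => q \notin P) (faces c))) => [/allP h _|].
          exact: dcell_faces.
        case/allPn => u uc /negPn uP; rewrite (@dcell_faces _ (mem Q)) ?addbF //.
        by move=> v vc; apply: contraL (faces_nbr c3 uc vc) => vQ; apply: nPQ.
      + by move=> p pP; apply: H1; rewrite inE pP orbT.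
      + move=> c c3 Lc; have := H2 c c3 Lc; rewrite dU.
        case: (boolP (all (fun q => q \notin P) (faces c))) => [/allP h|].
          by rewrite dcell_faces.
        case/allPn => u uc /negPn uP _; apply: dcell_faces.
        by move=> v vc; apply: contraL (faces_nbr c3 uc vc) => vQ; apply: nPQ.
    case=> /admissibleP[H1 H2] /admissibleP[H1' H2']; split=> [p|c c3 Lc].
      by rewrite inE => /orP[/H1|/H1'].
    by rewrite dU H2 // H2'.
  rewrite /wt adm; case: (admissible Lam P); last by rewrite mul0r.
  case: (admissible Lam Q) => /=; last by rewrite mulr0.
  have -> : #|` P `|` Q| = (#|` P| + #|` Q|)%N.
    rewrite -cardfsUI; have -> : P `&` Q = fset0; last by rewrite cardfs0 addn0.
    by apply/fsetP => z; rewrite !inE; apply/andP => -[/dis/negPf ->].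
  rewrite exprD mulrACA; congr (_ * _); rewrite /sgn -big_split /=.
  by apply: eq_bigr => p _; rewrite inU sgpM.
- move=> B; rewrite /wt; case: ifP => _; last by rewrite normr0 exprn_ge0.
  by rewrite normrM norm_sgn mulr1 ger0_norm ?exprn_ge0.
Qed.

Lemma eq_wt_sgn Lam l l' om :
  (admissible Lam om -> sgn l om = sgn l' om) -> wt Lam l om = wt Lam l' om.
Proof. by rewrite /wt; case: ifP => // _ ->. Qed.

(** A region is a predicate on cells; a finite set hosting it can be enlarged at will, so that two
    regions are compared inside a common set. *)
Definition hosts Lam A := forall p : cell, #|p.2| = 2%N -> Lam p -> p \in A.

Lemma psum_wt_host Lam l A A' : hosts Lam A -> A `<=` A' ->
  psum (wt Lam l) A' = psum (wt Lam l) A.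
Proof.
move=> hA AA'; rewrite /psum -(sum_fpowerset_sub _ AA') (bigID (fun B => B `<=` A)) /=.
rewrite [X in _ + X]big1 ?addr0 // => B nBA; rewrite /wt; case: admissibleP => // -[H _].
by case/negP: nBA; apply/fsubsetP => p /H[]; apply: hA.
Qed.

(** Logarithm of the expectation of the Wilson loop spanned by [l]; the empty list gives the
    normalising partition function. *)
Definition lr Lam A l : R := ln (psum (wt Lam l) A) - ln (psum (wt Lam [::]) A).

End Weights.

(** * Lattice symmetries, rectangles and cluster estimates *)

Section Automorphisms.
Variables (R : realType) (m : nat) (x : R) (pi : {perm 'I_m}) (a : vert m).
Local Notation cell := (cell m).
Implicit Types (c : cell) (om A : {fset cell}) (l : seq cell).

(** A permutation of the axes followed by a translation. Such maps send lowest corners to lowest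
    corners, which reflections would not. *)
Definition tauv (y : vert m) : vert m := [ffun l => y (pi^-1 l)%g + a l].
Definition tauc c : cell := (tauv c.1, [set pi z | z in c.2]).

Lemma tauv_addev y k n : tauv (y + ev k *+ n) = tauv y + ev (pi k) *+ n.
Proof.
apply/ffunP => l; have e : ((pi^-1)%g l == k) = (l == pi k).
  by rewrite -(inj_eq (@perm_inj _ pi)) permKV.
by rewrite ffunE !vertE ffunE e addrAC.
Qed.

Lemma tauc_inj : injective tauc.
Proof.
move=> [y E] [y' E'] [ey /imset_inj -> //]; last exact: perm_inj.
congr pair; apply/ffunP => l; have := congr1 (fun z : vert m => z (pi l)) ey.
by rewrite !ffunE permK => /addIr.
Qed.

Lemma tauc_surj c : exists c', c = tauc c'.
Proof.
exists ([ffun l => c.1 (pi l) - a (pi l)], [set (pi^-1)%g z | z in c.2]); case: c => y E.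
congr pair; first by apply/ffunP => l; rewrite !ffunE permKV subrK.
rewrite /= -imset_comp; apply/setP => z; apply/idP/imsetP => [zE|[z' z'E ->]].
  by exists z; rewrite //= permKV.
by rewrite /= permKV.
Qed.

Lemma dcell_tauc (f f' : cell -> bool) c : (forall c, f' (tauc c) = f c) ->
  dcell f' (tauc c) = dcell f c.
Proof.
move=> ff'; rewrite /dcell /= big_imset /=; last exact: in2W perm_inj.
apply: eq_bigr => l _.
have e : ([set pi z | z in c.2] :\ pi l = [set pi z | z in c.2 :\ l])%SET.
  apply/setP => z; rewrite -(permKV pi z) !inE !(mem_imset _ _ perm_inj) inE.
  by rewrite (inj_eq perm_inj) inE.
rewrite e -!ff' /tauc /=; congr (_ (+) f' (_, _)).
by have := tauv_addev c.1 l 1; rewrite !mulr1n.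
Qed.

Lemma psum_tauc (Lam Lam' : pred cell) l A : (forall c, Lam' (tauc c) = Lam c) ->
  psum (wt x Lam' (map tauc l)) (tauc @` A) = psum (wt x Lam l) A.
Proof.
move=> LL'; rewrite /psum.
have imK om : [fset c in A | tauc c \in tauc @` om] = om `&` A.
  by apply/fsetP => c; rewrite !inE (mem_imfset _ _ tauc_inj) andbC.
rewrite (sum_reindex_seq (s := fpowerset A) (h := fun om => tauc @` om)).
- apply: eq_bigr => om _.
  have adm : admissible Lam' (tauc @` om) = admissible Lam om.
    apply/admissibleP/admissibleP => -[H1 H2]; split.
    + move=> p pom; have := H1 (tauc p); rewrite (mem_imfset _ _ tauc_inj) => /(_ pom) /=.
      by rewrite card_imset ?LL' //; apply: perm_inj.
    + move=> c c3 Lc; rewrite -(H2 (tauc c)) ?LL' ?card_imset //; last exact: perm_inj.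
      by apply/esym/dcell_tauc => c'; apply: (mem_imfset _ _ tauc_inj).
    + move=> q /imfsetP[p /= pom ->]; rewrite /= card_imset; last exact: perm_inj.
      by rewrite LL'; apply: H1.
    + move=> c0; have [c ->] := tauc_surj c0; rewrite /= card_imset ?LL'; last exact: perm_inj.
      move=> c3 Lc; rewrite -(H2 c) //.
      by apply: dcell_tauc => c'; apply: (mem_imfset _ _ tauc_inj).
  rewrite /wt adm card_imfset; last exact: tauc_inj.
  case: ifP => // _; congr (_ * _); rewrite /sgn big_map; apply: eq_bigr => p _.
  by rewrite (mem_imfset _ _ tauc_inj).
- exact: fset_uniq.
- exact: fset_uniq.
- move=> B B'; rewrite !fpowersetE => BA B'A e.
  by rewrite -(fsetIidPl BA) -(fsetIidPl B'A) -!imK e.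
move=> B; rewrite fpowersetE; apply/idP/mapP => [BA|[om]]; last first.
  by rewrite fpowersetE => omA ->; apply: subset_imfset; apply/fsubsetP.
exists [fset c in A | tauc c \in B].
  by rewrite fpowersetE; apply/fsubsetP => c; rewrite !inE => /andP[].
apply/fsetP => c; apply/idP/imfsetP => [cB|[c' /=]]; last first.
  by rewrite !inE => /andP[_ c'B] ->.
have /imfsetP[c' /= c'A e] := fsubsetP BA c cB.
by exists c' => //=; rewrite !inE c'A -e.
Qed.

Lemma lr_tauc (Lam Lam' : pred cell) l A : (forall c, Lam' (tauc c) = Lam c) ->
  lr x Lam' (tauc @` A) (map tauc l) = lr x Lam A l.
Proof.
by move=> LL'; rewrite /lr (psum_tauc _ _ LL') -(psum_tauc [::] A LL').
Qed.

End Automorphisms.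

(** * Rectangles and their deformation *)

Section Rectangles.
Variables (R : realType) (m : nat).
Local Notation cell := (cell m).
Implicit Types (i j k : 'I_m) (a : vert m) (om : {fset cell}).

Definition rect i j a (Rl T : nat) : seq cell :=
  [seq (a + ev i *+ u + ev j *+ v, [set i; j]%SET) | u <- iota 0 Rl, v <- iota 0 T].

Lemma size_rect i j a Rl T : size (rect i j a Rl T) = (Rl * T)%N.
Proof. by rewrite size_allpairs !size_iota. Qed.

Lemma rectP i j a Rl T p : reflect
  (exists u v, [/\ (u < Rl)%N, (v < T)%N & p = (a + ev i *+ u + ev j *+ v, [set i; j]%SET)])
  (p \in rect i j a Rl T).
Proof.
apply: (iffP allpairsP) => [[[u v] /= []]|[u [v [uR vT ->]]]].
  by rewrite !mem_iota => uR vT ->; exists u, v.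
by exists (u, v); rewrite !mem_iota.
Qed.

Lemma sgn_rect i j a Rl T om :
  sgn R (rect i j a Rl T) om =
  \prod_(0 <= u < Rl) \prod_(0 <= v < T)
    sgp R ((a + ev i *+ u + ev j *+ v, [set i; j]%SET) \in om).
Proof. by rewrite /sgn /rect big_allpairs_dep /= /index_iota !subn0. Qed.

Lemma sgn_rect_bottom i j a Rl T om :
  sgn R (rect i j a Rl T.+1) om =
  sgn R (rect i j a Rl 1) om * sgn R (rect i j (a + ev j) Rl T) om.
Proof.
rewrite !sgn_rect -big_split; apply: eq_bigr => u _ /=.
rewrite big_nat1 big_nat_recl //; congr (_ * _); apply: eq_bigr => v _.
by rewrite mulrS -!addrA [X in a + X]addrCA.
Qed.

Lemma sgn_rect_top i j a Rl T om :
  sgn R (rect i j a Rl T.+1) om =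
  sgn R (rect i j a Rl T) om * sgn R (rect i j (a + ev j *+ T) Rl 1) om.
Proof.
rewrite !sgn_rect -big_split; apply: eq_bigr => u _ /=.
by rewrite big_nat1 big_nat_recr //= mulr0n addr0 addrAC.
Qed.

Lemma sgn_rect_swap i j a Rl T om :
  sgn R (rect i j a Rl T) om = sgn R (rect j i a T Rl) om.
Proof.
rewrite !sgn_rect exchange_big; apply: eq_bigr => v _; apply: eq_bigr => u _.
by rewrite addrAC finset.setUC.
Qed.

Lemma map_tauc_rect (pi : {perm 'I_m}) b i j a Rl T :
  map (tauc pi b) (rect i j a Rl T) = rect (pi i) (pi j) (tauv pi b a) Rl T.
Proof.
rewrite /rect map_allpairs; apply: eq_allpairs => u v; rewrite /tauc /=.
by rewrite !tauv_addev imsetU !imset_set1.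
Qed.

Lemma prod_telescope_sgp (g : nat -> bool) n :
  \prod_(0 <= u < n) sgp R (g u (+) g u.+1) = sgp R (g 0%N) * sgp R (g n).
Proof.
elim: n => [|n IH]; first by rewrite big_nil sgp_sqr.
by rewrite big_nat_recr //= IH sgpM -mulrA [X in _ * X]mulrA sgp_sqr mul1r.
Qed.

Lemma sgn_sqr l om : sgn R l om * sgn R l om = 1.
Proof. by rewrite /sgn -big_split big1 // => p _ /=; rewrite sgp_sqr. Qed.

(* The rectangle can be traded for the other five faces of any box standing on it. *)
Lemma sgn_rect_box (Lam : pred cell) i j k a Rl T h om :
  i != j -> i != k -> j != k -> admissible Lam om ->
  (forall u v z, (u < Rl)%N -> (v < T)%N -> (z < h)%N ->
     Lam (a + ev i *+ u + ev j *+ v + ev k *+ z, [set i; j; k]%SET)) ->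
  sgn R (rect i j a Rl T) om =
  sgn R (rect i j (a + ev k *+ h) Rl T) om *
  (sgn R (rect i k a Rl h) om * sgn R (rect i k (a + ev j *+ T) Rl h) om *
  (sgn R (rect j k a T h) om * sgn R (rect j k (a + ev i *+ Rl) T h) om)).
Proof.
move=> ij ik jk /admissibleP[_ cl] slab.
pose f (D : {set 'I_m}) u v z := (a + ev i *+ u + ev j *+ v + ev k *+ z, D) \in om.
(* Closedness makes the product of the signs over the six faces of each 3-cell of the box equal to
   1; multiplied over the box, the interior faces cancel in pairs. *)
have e1 : \prod_(0 <= u < Rl) \prod_(0 <= v < T) \prod_(0 <= z < h)
   (sgp R (f [set j; k]%SET u v z (+) f [set j; k]%SET u.+1 v z) *
   (sgp R (f [set i; k]%SET u v z (+) f [set i; k]%SET u v.+1 z) *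
    sgp R (f [set i; j]%SET u v z (+) f [set i; j]%SET u v z.+1))) = 1.
  rewrite big_nat big1 // => u /andP[_ uR]; rewrite big_nat big1 // => v /andP[_ vT].
  rewrite big_nat big1 // => z /andP[_ zh].
  have c3 : #|[set i; j; k]%SET| = 3%N.
    by rewrite -finset.setUA cardsU1 cards2 !inE negb_or ij ik jk.
  have := cl (a + ev i *+ u + ev j *+ v + ev k *+ z, [set i; j; k]%SET) c3 (slab _ _ _ uR vT zh).
  rewrite dcell3 // -!sgpM /f.
  have -> : a + ev i *+ u + ev j *+ v + ev k *+ z + ev i = a + ev i *+ u.+1 + ev j *+ v + ev k *+ z.
    by rewrite mulrSr addrA (addrAC _ (ev i) (ev j *+ v)) (addrAC _ (ev i) (ev k *+ z)).
  have -> : a + ev i *+ u + ev j *+ v + ev k *+ z + ev j = a + ev i *+ u + ev j *+ v.+1 + ev k *+ z.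
    by rewrite mulrSr addrA (addrAC _ (ev j) (ev k *+ z)).
  have -> : a + ev i *+ u + ev j *+ v + ev k *+ z + ev k = a + ev i *+ u + ev j *+ v + ev k *+ z.+1.
    by rewrite mulrSr !addrA.
  by move=> /= ->.
have e2 : \prod_(0 <= u < Rl) \prod_(0 <= v < T) \prod_(0 <= z < h)
    sgp R (f [set j; k]%SET u v z (+) f [set j; k]%SET u.+1 v z) =
    sgn R (rect j k a T h) om * sgn R (rect j k (a + ev i *+ Rl) T h) om.
  rewrite exchange_big !sgn_rect -big_split; apply: eq_bigr => v _ /=.
  rewrite exchange_big -big_split; apply: eq_bigr => z _ /=.
  by rewrite (prod_telescope_sgp (fun u => f _ u v z)) /f mulr0n addr0.
have e3 : \prod_(0 <= u < Rl) \prod_(0 <= v < T) \prod_(0 <= z < h)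
    sgp R (f [set i; k]%SET u v z (+) f [set i; k]%SET u v.+1 z) =
    sgn R (rect i k a Rl h) om * sgn R (rect i k (a + ev j *+ T) Rl h) om.
  rewrite !sgn_rect -big_split; apply: eq_bigr => u _ /=.
  rewrite exchange_big -big_split; apply: eq_bigr => z _ /=.
  rewrite (prod_telescope_sgp (fun v => f _ u v z)) /f mulr0n addr0.
  by rewrite (addrAC a (ev i *+ u) (ev j *+ T)).
have e4 : \prod_(0 <= u < Rl) \prod_(0 <= v < T) \prod_(0 <= z < h)
    sgp R (f [set i; j]%SET u v z (+) f [set i; j]%SET u v z.+1) =
    sgn R (rect i j a Rl T) om * sgn R (rect i j (a + ev k *+ h) Rl T) om.
  rewrite !sgn_rect -big_split; apply: eq_bigr => u _ /=.
  rewrite -big_split; apply: eq_bigr => v _ /=.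
  rewrite (prod_telescope_sgp (f _ u v)) /f mulr0n addr0.
  by rewrite (addrAC _ (ev j *+ v) (ev k *+ h)) (addrAC a (ev i *+ u) (ev k *+ h)).
move: e1; under eq_bigr do under eq_bigr do rewrite !big_split /=.
under eq_bigr do rewrite !big_split /=.
rewrite !big_split /= e2 e3 e4 => e1.
have alg (S Sh X Y : R) : S * S = 1 -> Y * (X * (S * Sh)) = 1 -> S = Sh * (X * Y).
  move=> S2 e; rewrite -[S]mulr1 -e [RHS](_ : _ = S * S * (Sh * (X * Y))); first by ring.
  by rewrite S2 mul1r.
exact: alg (sgn_sqr _ _) e1.
Qed.

End Rectangles.

(** * Locality, second differences and perimeter bound *)

Section Estimates.
Variables (R : realType) (m : nat) (x s t : R).
Hypotheses (m3 : (2 < m)%N) (x0 : 0 <= x) (s1 : 1 < s) (t0 : 0 <= t) (t1 : t < 1).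
Hypothesis xst : x * s * ((1 + t) / (1 - t)) ^+ (12 * (m - 2)) <= t.
Local Notation cell := (cell m).
Implicit Types (Lam : pred cell) (A C : {fset cell}) (l : seq cell).
Implicit Types (i j k : 'I_m) (a : vert m).

Let c0 := t / (1 - t).
Let c00 : 0 <= c0. Proof. by rewrite divr_ge0 // subr_ge0 ltW. Qed.
Let s0 : 0 < s. Proof. exact: lt_trans s1. Qed.

Let tail := @cluster_tail R cell (@nbr m) (12 * (m - 2)) x s t (fun p => nbr_refl p m3)
  (fun p => size_nbr p m3) x0 (ltW s1) t0 t1 xst.

Lemma psum_wt_gt0 Lam l A : 0 < psum (wt x Lam l) A.
Proof.
exact: (psum_gt0 (fun p => nbr_refl p m3) (fun p => size_nbr p m3) x0 (ltW s1) t0 t1 xst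
  (polymer_wt m3 x0 Lam l)).
Qed.

Lemma lrE Lam A l : lr x Lam A l =
  \sum_(C <- fpowerset A) (cluster (wt x Lam l) C - cluster (wt x Lam [::]) C).
Proof. by rewrite /lr sumrB !ln_psum. Qed.

Lemma eq_cluster_lam Lam Lam' l C :
  (forall c q, q \in C -> c = q \/ q \in faces c -> Lam c = Lam' c) ->
  cluster (wt x Lam l) C = cluster (wt x Lam' l) C.
Proof.
move=> LL'; apply: eq_cluster => B /fsubsetP BC; rewrite /wt.
suff -> : admissible Lam B = admissible Lam' B by [].
have aux (L L' : pred cell) : (forall c q, q \in C -> c = q \/ q \in faces c -> L c = L' c) ->
    admissible L B -> admissible L' B.
  move=> LL /admissibleP[H1 H2]; apply/admissibleP; split=> [p pB|c c3 Lc].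
    have [p2 Lp] := H1 p pB; split=> //; rewrite -(LL p p) ?BC //; by left.
  case: (boolP (has (mem B) (faces c))) => [/hasP[q qc qB]|/hasPn h]; last first.
    exact: dcell_faces.
  by apply: H2 => //; rewrite (LL c q) ?BC //; right.
by apply/idP/idP; apply: aux => // c q qC h; rewrite (LL' c q).
Qed.

Lemma eq_cluster_sgn Lam l l' C :
  (forall B, B `<=` C -> admissible Lam B -> sgn R l B = sgn R l' B) ->
  cluster (wt x Lam l) C = cluster (wt x Lam l') C.
Proof. by move=> e; apply: eq_cluster => B BC; apply: eq_wt_sgn; apply: e. Qed.

Lemma sgn_avoid l B C : B `<=` C -> ~~ has (mem C) l -> sgn R l B = 1.
Proof.
move=> BC /hasPn H; apply: sgn_disjoint => p pl.
by apply: contraNN (H p pl) => /(fsubsetP BC).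
Qed.

(** A set missing [l] does not distinguish the loop from no loop. A set meeting [l] with fewer than
    [n] plaquettes stays where both regions agree. Only larger sets survive. *)
Lemma lr_local Lam Lam' A A' l n : hosts Lam A -> hosts Lam' A' ->
  (forall p c : cell, p \in l -> (forall k, (`|c.1 k - p.1 k| <= n)%N) -> Lam c /\ Lam' c) ->
  `|lr x Lam A l - lr x Lam' A' l| <= 4 * c0 * (size l)%:R * s ^- n.
Proof.
move=> hA hA' near.
have -> : lr x Lam A l = lr x Lam (A `|` A') l.
  by rewrite /lr !(psum_wt_host _ _ hA (fsubsetUl A A')).
have -> : lr x Lam' A' l = lr x Lam' (A `|` A') l.
  by rewrite /lr !(psum_wt_host _ _ hA' (fsubsetUr A A')).
rewrite !lrE -sumrB.
pose ws := [:: wt x Lam l; wt x Lam [::]; wt x Lam' l; wt x Lam' [::]].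
refine (le_trans (@tail ws _ _ l (fun=> n) _ _ _) _).
- move=> C; rewrite !big_cons big_nil addr0.
  apply: le_trans (ler_normB _ _) _; rewrite addrA.
  by apply: lerD; apply: ler_normB.
- by repeat (apply: List.Forall_cons; first exact: polymer_wt).
- move=> C /= nz cC.
  have [p pl pC] : exists2 p, p \in l & p \in C.
    apply/hasP; apply: contraNT nz => h.
    rewrite !(@eq_cluster_sgn _ l [::]) ?subrr // => B BC _;
      by rewrite (sgn_avoid BC h) /sgn big_nil.
  exists p; split=> //; rewrite leqNgt; apply: contraNN nz => nC.
  have LL c q : q \in C -> c = q \/ q \in faces c -> Lam c = Lam' c.
    move=> qC h; suff [-> ->] : Lam c /\ Lam' c by [].
    apply: (near p) => // k; have := conn_dist k (cC p pC) qC.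
    case: h => [->|/allpairsP[[i b] /= [_ _ ->]]] /=; first by move=> h; apply: ltnW (ltn_trans h nC).
    (* The strict inequality in [conn_dist] leaves room for the corner of a 3-cell one step below
       that of its face. *)
    rewrite !vertE => h; apply: leq_trans (leq_trans h (ltnW nC)).
    by case: b {h}; case: (k == i); move: (c.1 k) (p.1 k) => X Y; clear; lia.
  by rewrite !(eq_cluster_lam _ LL) subrr.
- by rewrite big_const_seq count_predT iter_addr_0 -[X in _ * X]mulr_natl [leLHS]mulrA; apply: lexx.
Qed.

(** A set missing the bottom row identifies [l1] with [l4] and [l3] with [l2]; one missing the top
    row identifies [l1] with [l3] and [l4] with [l2]. The survivors are charged to the bottom row,
    whence the factor [Rl]. *)
Lemma lr_second_diff Lam A i j a Rl T : i != j ->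
  `|lr x Lam A (rect i j a Rl T.+2) + lr x Lam A (rect i j (a + ev j) Rl T) -
    (lr x Lam A (rect i j a Rl T.+1) + lr x Lam A (rect i j (a + ev j) Rl T.+1))|
  <= 4 * c0 * Rl%:R * s ^- T.
Proof.
move=> ij; set l1 := rect i j a Rl T.+2; set l2 := rect i j (a + ev j) Rl T.
set l3 := rect i j a Rl T.+1; set l4 := rect i j (a + ev j) Rl T.+1.
pose ph l C := cluster (wt x Lam l) C.
have -> : lr x Lam A l1 + lr x Lam A l2 - (lr x Lam A l3 + lr x Lam A l4) =
    \sum_(C <- fpowerset A) (ph l1 C - ph l3 C - (ph l4 C - ph l2 C)).
  by rewrite !lrE !sumrB /ph; ring.
pose ws := [:: wt x Lam l1; wt x Lam l3; wt x Lam l4; wt x Lam l2].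
refine (le_trans (@tail ws _ _ (rect i j a Rl 1) (fun=> T) _ _ _) _).
- move=> C; rewrite !big_cons big_nil addr0.
  apply: le_trans (ler_normB _ _) _; rewrite addrA.
  by apply: lerD; apply: ler_normB.
- by repeat (apply: List.Forall_cons; first exact: polymer_wt).
- move=> C /= nz cC.
  have [p pl pC] : exists2 p, p \in rect i j a Rl 1 & p \in C.
    apply/hasP; apply: contraNT nz => h.
    have -> : ph l1 C = ph l4 C.
      by apply: eq_cluster_sgn => B BC _; rewrite sgn_rect_bottom (sgn_avoid BC h) mul1r.
    have -> : ph l3 C = ph l2 C.
      by apply: eq_cluster_sgn => B BC _; rewrite sgn_rect_bottom (sgn_avoid BC h) mul1r.
    by rewrite subrr.
  have [q ql qC] : exists2 q, q \in rect i j (a + ev j *+ T.+1) Rl 1 & q \in C.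
    apply/hasP; apply: contraNT nz => h.
    have -> : ph l1 C = ph l3 C.
      by apply: eq_cluster_sgn => B BC _; rewrite sgn_rect_top (sgn_avoid BC h) mulr1.
    have -> : ph l4 C = ph l2 C.
      apply: eq_cluster_sgn => B BC _; rewrite sgn_rect_top.
      by rewrite -addrA -mulrS (sgn_avoid BC h) mulr1.
    by rewrite !subrr.
  exists p; split=> //; have := conn_dist j (cC p pC) qC.
  case/rectP: pl => u [v [_ + ->]]; case/rectP: ql => u' [v' [_ + ->]].
  rewrite !ltnS !leqn0 => /eqP -> /eqP -> /=.
  rewrite !vertE eqxx eq_sym (negPf ij) => h; apply: leq_trans (ltnW h).
  by move: (a j) => X; clear; lia.
- by rewrite big_const_seq count_predT iter_addr_0 size_rect muln1 -[X in _ * X]mulr_natl [leLHS]mulrA; apply: lexx.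
Qed.

Let geo := s / (s - 1).

Lemma sum_geo n : \sum_(0 <= u < n) s ^- u <= geo.
Proof.
have s1' : 0 < s - 1 by rewrite subr_gt0.
suff -> : \sum_(0 <= u < n) s ^- u = geo - geo * s ^- n.
  by rewrite gerBl mulr_ge0 ?invr_ge0 ?exprn_ge0 ?divr_ge0 ?(ltW s0) ?(ltW s1').
elim: n => [|n IH]; first by rewrite big_nil expr0 invr1 mulr1 subrr.
rewrite big_nat_recr //= IH exprS invfM /geo; field.
by rewrite !gt_eqF ?exprn_gt0.
Qed.

Lemma sum_geo_rev n : \sum_(0 <= u < n) s ^- (n - u) <= geo.
Proof.
rewrite big_nat_rev /= add0n; apply: le_trans (sum_geo n).
rewrite big_nat [leRHS]big_nat; apply: ler_sum => u /andP[_ un].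
by rewrite lef_pV2 ?posrE ?exprn_gt0 // ler_weXn2l ?(ltW s1) // subKn // ltnW.
Qed.

Lemma exprV_minn p q : s ^- minn p q <= s ^- p + s ^- q.
Proof.
by case: (leqP p q) => h; rewrite ?lerDl ?lerDr invr_ge0 exprn_ge0 ?(ltW s0).
Qed.

(** The area survives only through the lid of the box, with a factor [s ^- h] that disappears as [h]
    grows; the four walls give geometric series along the sides. *)
Lemma lr_perimeter Lam A i j k a Rl T h : i != j -> i != k -> j != k ->
  (forall u v z, (u < Rl)%N -> (v < T)%N -> (z < h)%N ->
     Lam (a + ev i *+ u + ev j *+ v + ev k *+ z, [set i; j; k]%SET)) ->
  `|lr x Lam A (rect i j a Rl T)| <=
  2 * c0 * ((Rl * T)%:R * s ^- h + 2 * geo * (Rl + T)%:R).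
Proof.
move=> ij ik jk slab; rewrite lrE.
(* A connected set through [p] that reaches the lid or a wall has at least this many plaquettes. *)
pose n (p : cell) := let u := `|p.1 i - a i|%N in let v := `|p.1 j - a j|%N in
  minn h (minn (minn u (Rl - u)) (minn v (T - v))).
pose ws := [:: wt x Lam (rect i j a Rl T); wt x Lam [::]].
refine (le_trans (@tail ws _ _ (rect i j a Rl T) n _ _ _) _).
- by move=> C; rewrite !big_cons big_nil addr0; apply: ler_normB.
- by repeat (apply: List.Forall_cons; first exact: polymer_wt).
- move=> C /= nz cC.
  have [p pl pC] : exists2 p, p \in rect i j a Rl T & p \in C.
    apply/hasP; apply: contraNT nz => h'.
    rewrite (@eq_cluster_sgn _ _ [::]) ?subrr // => B BC _.
    by rewrite (sgn_avoid BC h') /sgn big_nil.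
  exists p; split=> //.
  pose bowl := rect i j (a + ev k *+ h) Rl T ++ rect i k a Rl h ++
    rect i k (a + ev j *+ T) Rl h ++ rect j k a T h ++ rect j k (a + ev i *+ Rl) T h.
  have [q ql qC] : exists2 q, q \in bowl & q \in C.
    apply/hasP; apply: contraNT nz.
    rewrite /bowl !has_cat !negb_or => /and5P[h1 h2 h3 h4 h5].
    rewrite (@eq_cluster_sgn _ _ [::]) ?subrr // => B BC adm.
    rewrite (sgn_rect_box _ ij ik jk adm slab).
    by rewrite !(@sgn_avoid _ _ _ BC) // !mulr1.
  have [ji ki kj] : [/\ j != i, k != i & k != j].
    by split; rewrite eq_sym.
  have di := conn_dist i (cC p pC) qC; have dj := conn_dist j (cC p pC) qC.
  have dk := conn_dist k (cC p pC) qC; rewrite /n.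
  case/rectP: pl di dj dk {pC} => u [v [uR vT ->]] /=.
  rewrite !vertE !eqxx ?(negPf ij) ?(negPf ji) ?(negPf ki) ?(negPf kj) ?(negPf ik) ?(negPf jk).
  move: ql; rewrite !mem_cat => /or4P[|||/orP[]] /rectP[u' [v' [uR' vT' ->]]] /=;
  rewrite !vertE ?eqxx ?(negPf ij) ?(negPf ji) ?(negPf ki) ?(negPf kj) ?(negPf ik) ?(negPf jk)
    => di dj dk.
  - by apply: leq_trans (ltnW dk); move: (a i) (a j) (a k) => X Y Z'; clear -uR vT; lia.
  - by apply: leq_trans (ltnW dj); move: (a i) (a j) (a k) => X Y Z'; clear -uR vT; lia.
  - by apply: leq_trans (ltnW dj); move: (a i) (a j) (a k) => X Y Z'; clear -uR vT; lia.
  - by apply: leq_trans (ltnW di); move: (a i) (a j) (a k) => X Y Z'; clear -uR vT; lia.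
  - by apply: leq_trans (ltnW di); move: (a i) (a j) (a k) => X Y Z'; clear -uR vT; lia.
apply: ler_wpM2l; first by apply: mulr_ge0.
pose e u v := s ^- h + (s ^- u + s ^- (Rl - u) + (s ^- v + s ^- (T - v))).
apply: (@le_trans _ _ (\sum_(0 <= u < Rl) \sum_(0 <= v < T) e u v)).
  rewrite /rect big_allpairs_dep /= /index_iota !subn0.
  have ji : j != i by rewrite eq_sym.
  apply: ler_sum => u _; apply: ler_sum => v _; rewrite /n /= !vertE !eqxx (negPf ij) (negPf ji).
  have -> : (`|(a i + (1 * u)%N + (0 * v)%N - a i)%R| = u)%N by move: (a i); clear; lia.
  have -> : (`|(a j + (0 * u)%N + (1 * v)%N - a j)%R| = v)%N by move: (a j); clear; lia.
  apply: le_trans (exprV_minn _ _) _; rewrite lerD2l.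
  by apply: le_trans (exprV_minn _ _) _; apply: lerD; apply: exprV_minn.
rewrite /e; under eq_bigr do rewrite !big_split /= !sumr_const_nat subn0.
rewrite !big_split /= !sumr_const_nat subn0 !sumrMnl.
have h1 := sum_geo Rl; have h2 := sum_geo_rev Rl; have h3 := sum_geo T; have h4 := sum_geo_rev T.
rewrite -mulrnA mulnC -[s ^- h *+ _]mulr_natl lerD2l -!mulrnDl.
have -> : 2 * geo * (Rl + T)%:R = (geo + geo) *+ T + (geo + geo) *+ Rl.
  by rewrite addnC mulr_natr mulrnDr mulr_natl mulr2n.
by apply: lerD; apply: ler_wMn2r; apply: lerD.
Qed.

End Estimates.

(** * Closed forms on a box *)

Section OneForms.
Variable m : nat.
Local Notation cell := (cell m).
Local Notation vert := (vert m).
Implicit Types (s : vert -> 'I_m -> bool) (f g : cell -> bool) (v y : vert).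
Implicit Types (i j k l : 'I_m) (c : cell) (N : nat).

(** The form is summed along both monotone paths across the plaquette, so that its two directions
    need not be ordered. *)
Definition d1 s c : bool := \big[addb/false]_(i in c.2)
  (s c.1 i (+) \big[addb/false]_(j in (c.2 :\ i)%SET) s (c.1 + ev i) j).

Lemma d1_pair s v i j : i != j ->
  d1 s (v, [set i; j]%SET) = s v i (+) s (v + ev i) j (+) (s v j (+) s (v + ev j) i).
Proof.
move=> ij; have ji : j != i by rewrite eq_sym.
rewrite /d1 /= big_setU1 ?inE //= big_set1.
have -> : ([set i; j] :\ i = [set j])%SET by rewrite finset.setU1K // inE.
have -> : ([set i; j] :\ j = [set i])%SET by rewrite finset.setUC finset.setU1K // inE.
by rewrite !big_set1.
Qed.

Lemma d1_add s s' c : d1 (fun v i => s v i (+) s' v i) c = d1 s c (+) d1 s' c.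
Proof.
rewrite /d1 -big_split; apply: eq_bigr => i _ /=.
by rewrite big_split /= addbACA.
Qed.

Lemma dcell_add f g c : dcell (fun c => f c (+) g c) c = dcell f c (+) dcell g c.
Proof. by rewrite /dcell -big_split; apply: eq_bigr => l _; rewrite addbACA. Qed.

Lemma card3P (E : {set 'I_m}) : #|E| = 3%N ->
  exists i j k, [/\ i != j, i != k, j != k & E = [set i; j; k]%SET].
Proof.
move=> E3; have [i iE] : exists i, i \in E by apply/card_gt0P; rewrite E3.
have /eqP/cards2P[j [k [jk e]]] : #|E :\ i|%SET = 2%N.
  by have := cardsD1 i E; rewrite E3 iE => -[].
have hj : j \in (E :\ i)%SET by rewrite e !inE eqxx.
have hk : k \in (E :\ i)%SET by rewrite e !inE eqxx orbT.
move: hj hk; rewrite !inE => /andP[ji _] /andP[ki _].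
exists i, j, k; rewrite -finset.setUA -e finset.setD1K // eq_sym ji eq_sym ki; split=> //.
Qed.

Lemma dcell_d1 s c : #|c.2| = 3%N -> dcell (d1 s) c = false.
Proof.
case: c => v E /= /card3P[i [j [k [ij ik jk ->]]]].
rewrite dcell3 // !d1_pair // (addrAC v (ev k) (ev i)) (addrAC v (ev k) (ev j)).
rewrite (addrAC v (ev j) (ev i)).
move: (s v i) (s v j) (s v k) (s (v + ev i) j) (s (v + ev i) k) (s (v + ev j) i).
move: (s (v + ev j) k) (s (v + ev k) i) (s (v + ev k) j).
move: (s (v + ev i + ev j) k) (s (v + ev i + ev k) j) (s (v + ev j + ev k) i).
by do 12! case.
Qed.

Definition box N : pred cell :=
  fun c => [forall k, (- N%:Z <= c.1 k) && (c.1 k + ((k \in c.2) : nat)%:Z <= N%:Z)].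

Lemma boxP N c : reflect
  (forall k, - N%:Z <= c.1 k /\ c.1 k + ((k \in c.2) : nat)%:Z <= N%:Z) (box N c).
Proof.
apply: (iffP forallP) => H k; first by apply/andP/H.
by apply/andP/H.
Qed.

Lemma box_sub N v (D E : {set 'I_m}) : D \subset E -> box N (v, E) -> box N (v, D).
Proof.
move=> /fintype.subsetP DE /boxP H; apply/boxP => k /=; have [h1 h2] := H k; split=> //.
apply: le_trans h2; rewrite lerD2l lez_nat; have := DE k.
by case: (k \in D) => // /(_ isT) ->.
Qed.

Lemma box_shift N v (D E : {set 'I_m}) l : D \subset E -> l \in E -> l \notin D ->
  box N (v, E) -> box N (v + ev l, D).
Proof.
move=> /fintype.subsetP DE lE lD /boxP H; apply/boxP => k /=; have [h1 h2] := H k.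
rewrite !vertE; split; first by apply: le_trans h1 _; rewrite lerDl.
apply: le_trans h2; rewrite -addrA lerD2l -PoszD lez_nat; have := DE k.
case: eqVneq => [->|_]; first by rewrite lE (negPf lD).
by case: (k \in D) => // /(_ isT) ->.
Qed.

Lemma dcell_box f g N c : #|c.2| = 3%N -> box N c ->
  (forall q : cell, #|q.2| = 2%N -> box N q -> f q = g q) -> dcell f c = dcell g c.
Proof.
case: c => y E /= c3 bc fg; rewrite /dcell; apply: eq_bigr => l /= lE.
have E2 : #|(E :\ l)%SET| = 2%N by have := cardsD1 l E; rewrite c3 lE => -[].
rewrite !fg //; last exact: box_sub (finset.subD1set _ _) bc.
by apply: box_shift bc; rewrite ?finset.subD1set // !inE eqxx.
Qed.

Definition setk k v (z : nat) N : vert := [ffun l => if l == k then z%:Z - N%:Z else v l].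

(* Axial gauge: integrate the form along direction [k], one direction after the
   other; closedness keeps the directions already treated at zero. *)
Lemma poincare_step N f (n : nat) (nm : (n < m)%N) :
  (forall c, #|c.2| = 3%N -> box N c -> dcell f c = false) ->
  (forall c, #|c.2| = 2%N -> box N c -> (exists2 k, k \in c.2 & (k < n)%N) -> f c = false) ->
  exists s, forall c, #|c.2| = 2%N -> box N c ->
    (exists2 k, k \in c.2 & (k < n.+1)%N) -> f c (+) d1 s c = false.
Proof.
move=> cl f0; pose k := Ordinal nm.
pose s v l := if l == k then false else
  \big[addb/false]_(0 <= z < `|(v k + N%:Z)%R|%N) f (setk k v z N, [set k; l]%SET).
exists s => -[v E] /= /eqP/cards2P[i [j [ij ->]]] bc [l lE ln].
have [kE|kE] := boolP (k \in [set i; j]%SET).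
  wlog ik : i j ij bc lE kE / i = k.
    move=> H; move: (kE); rewrite !inE => /orP[]/eqP e; first exact: H.
    by rewrite finset.setUC; apply: H; rewrite 1?finset.setUC // eq_sym.
  (* The two sums in direction [k] differ by their last term, which is [f] at the plaquette
     itself. *)
  subst i; rewrite d1_pair // /s eqxx eq_sym (negPf ij) /=.
  have [h1 h2] := boxP _ _ bc k; rewrite /= !inE eqxx /= in h1 h2.
  have -> : (`|((v + ev k) k + N%:Z)%R| = `|(v k + N%:Z)%R|.+1)%N.
    rewrite !vertE eqxx; move: (v k) h1 => V; clear; lia.
  rewrite big_nat_recr //=.
  have -> : setk k (v + ev k) `|(v k + N%:Z)%R| N = v.
    apply/ffunP => z; rewrite !ffunE; case: eqVneq => [->|_]; last by rewrite addr0.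
    move: (v k) h1 => V; clear; lia.
  rewrite (eq_bigr (fun z => f (setk k v z N, [set k; j]%SET))) => [|z _]; last first.
    congr (f (_, _)); apply/ffunP => w; rewrite !ffunE.
    by case: eqVneq => // _; rewrite addr0.
  by case: (f _); case: (\big[_/_]_(_ <= _ < _) _).
have [ik jk] : i != k /\ j != k.
  by move: kE; rewrite !inE negb_or ![k == _]eq_sym => /andP.
have {l lE ln} [l [l' [lE ll' lk l'k ln]]] : exists l l',
    [/\ [set i; j]%SET = [set l; l']%SET, l != l', l != k, l' != k & (l < n)%N].
  have ln' : (l < n)%N.
    rewrite ltn_neqAle -ltnS ln andbT; apply: contraNneq kE => e.
    by have <- : l = k by apply: val_inj.
  move: lE; rewrite !inE => /orP[]/eqP e; subst l; first by exists i, j.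
  by exists j, i; split=> //; [exact: finset.setUC|rewrite eq_sym].
(* Now [k] is not a direction of the plaquette, and [f] vanishes on all plaquettes of the box having
   the treated direction [l]. The sums defining [s] along [l] are zero, and closedness of the
   3-cells in directions [k], [l], [l'] cancels the other two sums term by term. *)
rewrite lE in bc *; rewrite f0 //; last 2 first.
- by rewrite cards2 ll'.
- by exists l; rewrite // !inE eqxx.
rewrite d1_pair // /s (negPf lk) (negPf l'k) /=.
have bcE w := boxP _ _ bc w.
have sub y z : (z < `|(v k + N%:Z)%R|)%N -> (forall w, w != k -> - N%:Z <= y w) ->
   forall D : {set 'I_m}, (forall w, w != k -> y w + ((w \in D) : nat)%:Z <= N%:Z) ->
   box N (setk k y z N, D).
  move=> zv h1 D h2; apply/boxP => w /=; rewrite ffunE.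
  case: eqVneq => [->|wk]; last by split; [exact: h1|exact: h2].
  have [h3 h4] := bcE k; move: h3 h4 zv; rewrite /= !inE ![k == _]eq_sym (negPf lk) (negPf l'k) /=.
  move: (v k) => V; clear; case: (k \in D) => /=; lia.
have bc1 w : w != k -> - N%:Z <= v w by have [] := bcE w.
have bc2 w (D : {set 'I_m}) : ((w \in D) <= (w \in [set l; l']%SET))%N ->
    v w + ((w \in D) : nat)%:Z <= N%:Z.
  by move=> h; have [_ h2] := bcE w; apply: le_trans h2; rewrite lerD2l lez_nat.
have bx z : (z < `|(v k + N%:Z)%R|)%N -> box N (setk k v z N, [set k; l; l']%SET).
  move=> zv; apply: sub => // w wk; apply: bc2; rewrite !inE (negPf wk) /=.
  by case: (w == l); case: (w == l').
have card2 (w w' : 'I_m) : w != w' -> #|[set w; w']%SET| = 2%N by move=> h; rewrite cards2 h.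
have setkD z w : w != k -> setk k (v + ev w) z N = setk k v z N + ev w.
  move=> wk; apply/ffunP => w'; rewrite !ffunE; case: (eqVneq w' k) => // ->.
  by rewrite eq_sym (negPf wk) addr0.
have kl : k != l by rewrite eq_sym.
have kl' : k != l' by rewrite eq_sym.
have s1 : [set k; l]%SET \subset [set k; l; l']%SET.
  by apply/fintype.subsetP => w; rewrite !inE => ->.
have s2 : [set l; l']%SET \subset [set k; l; l']%SET.
  by apply/fintype.subsetP => w; rewrite !inE => /orP[] ->; rewrite ?orbT.
have lin (D : {set 'I_m}) : l \in D -> exists2 w, w \in D & (w < n)%N by exists l.
have evk w : w != k -> (v + ev w) k = v k.
  by move=> wk; rewrite !vertE eq_sym (negPf wk) addr0.
rewrite big_nat big1 => [|z /andP[_ zv]]; last first.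
  apply: f0; rewrite /= ?card2 //; first exact: box_sub s1 (bx z zv).
  by apply: lin; rewrite !inE eqxx orbT.
rewrite [X in _ (+) (_ (+) X)]big_nat [X in _ (+) (_ (+) X)]big1; last first.
  rewrite evk // => z /andP[_ zv]; rewrite setkD //.
  apply: f0; rewrite /= ?card2 //; last by apply: lin; rewrite !inE eqxx orbT.
  by apply: box_shift s1 _ _ (bx z zv); rewrite !inE ?eqxx ?orbT // negb_or ![l' == _]eq_sym ll' kl'.
rewrite evk // addbF /= -big_split big_nat big1 //= => z zv.
rewrite setkD //; have := cl (setk k v z N, [set k; l; l']%SET).
rewrite dcell3 // bx //= (f0 (_, [set l; l']%SET)) ?(f0 (_ + ev k, [set l; l']%SET)) //=.
- rewrite (f0 (_, [set k; l]%SET)) ?(f0 (_ + ev l', [set k; l]%SET)) //=.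
  + rewrite addbF addbC; apply=> //.
    by rewrite -finset.setUA cardsU1 cards2 !inE negb_or kl kl' ll'.
  + exact: card2.
  + by apply: box_shift s1 _ _ (bx z zv); rewrite !inE ?eqxx ?orbT // negb_or ![l' == _]eq_sym ll' kl'.
  + by apply: lin; rewrite !inE eqxx orbT.
  + exact: card2.
  + exact: box_sub s1 (bx z zv).
  + by apply: lin; rewrite !inE eqxx orbT.
- exact: card2.
- by apply: box_shift s2 _ _ (bx z zv); rewrite !inE ?eqxx ?orbT // negb_or kl kl'.
- by apply: lin; rewrite !inE eqxx.
- exact: card2.
- exact: box_sub s2 (bx z zv).
- by apply: lin; rewrite !inE eqxx.
Qed.

(** The partial primitives of all stages are added up; after [m] stages every plaquette has a
    treated direction. *)
Lemma poincare N f :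
  (forall c, #|c.2| = 3%N -> box N c -> dcell f c = false) ->
  exists s, forall c, #|c.2| = 2%N -> box N c -> d1 s c = f c.
Proof.
move=> cl.
have H n : (n <= m)%N -> exists s, forall c, #|c.2| = 2%N -> box N c ->
    (exists2 k, k \in c.2 & (k < n)%N) -> f c (+) d1 s c = false.
  elim: n => [_|n IH nm]; first by exists (fun _ _ => false) => c _ _ [].
  have [s Hs] := IH (ltnW nm).
  have cl' c : #|c.2| = 3%N -> box N c -> dcell (fun c => f c (+) d1 s c) c = false.
    by move=> c3 bc; rewrite dcell_add cl // dcell_d1.
  have [s' Hs'] := poincare_step nm cl' Hs.
  exists (fun v i => s v i (+) s' v i) => c c2 bc hc.
  by rewrite d1_add addbA Hs'.
have [s Hs] := H m (leqnn m); exists s => c c2 bc; apply/eqP.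
rewrite -[d1 s c]addFb eq_sym -(inj_eq (@addIb (d1 s c))) Hs ?addbb //.
have [k kc] : exists k, k \in c.2 by apply/card_gt0P; rewrite c2.
by exists k.
Qed.

End OneForms.

(** * The finite-volume Gibbs measure as a polymer gas *)

Section Box.
Variables (R : realType) (m N : nat).
Local Notation cell := (cell m).
Local Notation vert := (vert m).
Implicit Types (y : bvert m N) (v : vert) (c : cell) (i j k : 'I_m) (sigma tau : bconf m N).

Definition ofb y : vert := [ffun k => (y k : nat)%:Z - N%:Z].
Definition tob v : bvert m N := to_box N (fun k => v k).
Definition inbox v := forall k, - N%:Z <= v k /\ v k <= N%:Z.

Lemma tobE v k : - N%:Z <= v k -> v k <= N%:Z -> (tob v k : nat) = `|(v k + N%:Z)%R|%N.
Proof. by move=> h1 h2; rewrite ffunE inordK //; move: (v k) h1 h2 => V; clear; lia. Qed.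

Lemma ofbK y : tob (ofb y) = y.
Proof.
apply/ffunP => k; apply: val_inj; have hk := ltn_ord (y k).
rewrite /= tobE !ffunE; move: (nat_of_ord (y k)) hk => Y; clear; lia.
Qed.

Lemma tobK v : inbox v -> ofb (tob v) = v.
Proof.
move=> H; apply/ffunP => k; have [h1 h2] := H k; rewrite ffunE tobE //.
by move: (v k) h1 h2 => V; clear; lia.
Qed.

Lemma tob_addev y k : (y k < 2 * N)%N -> tob (ofb y + ev k) = bshift y k.
Proof.
move=> yk; apply/ffunP => l; apply: val_inj => /=; have hl := ltn_ord (y l).
rewrite tobE !ffunE; case: eqVneq => [lk|_] /=; try subst l;
  rewrite ?inordK; move: (y _ : nat) hl yk => Y; clear; lia.
Qed.

Lemma box_inbox c : box N c -> inbox c.1.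
Proof.
move=> /boxP H k; have [h1 h2] := H k; split=> //; apply: le_trans h2.
by rewrite lerDl.
Qed.

Definition plaqs : {fset cell} :=
  [fset c in [seq ((ofb q.1, q.2) : cell) |
     q : (bvert m N * {set 'I_m})%type <- enum {: bvert m N * {set 'I_m}} &
     (#|q.2| == 2%N) && box N (ofb q.1, q.2)]].

Lemma in_plaqs c : (c \in plaqs) = (#|c.2| == 2%N) && box N c.
Proof.
rewrite !inE; apply/mapP/idP => [[q]|].
  by rewrite mem_filter => /andP[h _] ->.
move=> /andP[c2 bc]; have e := tobK (box_inbox bc); exists (tob c.1, c.2).
  by rewrite mem_filter mem_enum /= e c2 -surjective_pairing bc.
by rewrite /= e -surjective_pairing.
Qed.

Definition edgef sigma v k : bool := sigma (tob v, k).
Definition curv sigma : {fset cell} := [fset c in plaqs | d1 (edgef sigma) c].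

Lemma in_curv sigma c : (c \in curv sigma) = (c \in plaqs) && d1 (edgef sigma) c.
Proof. by rewrite !inE. Qed.

Lemma dsig_d1 sigma y i j : bplaq_ok y i j ->
  dsig sigma y i j = d1 (edgef sigma) (ofb y, [set i; j]%SET).
Proof.
case/and3P => ij yi yj; have ij' : i != j by apply: contraTneq ij => ->; rewrite ltnn.
rewrite d1_pair // /dsig /edgef ofbK !tob_addev // -!addbA; congr (_ (+) (_ (+) _)).
by rewrite addbC.
Qed.

Lemma bplaq_box y i j : i != j ->
  box N (ofb y, [set i; j]%SET) = (y i < 2 * N)%N && (y j < 2 * N)%N.
Proof.
move=> ij; apply/boxP/andP => [H|[yi yj] k].
  have [_] := H i; have [_] := H j; rewrite /= !inE !eqxx orbT !ffunE /=.
  move: (nat_of_ord (y i)) (nat_of_ord (y j)) => Y Y'; clear; lia.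
rewrite /= !inE !ffunE; have := ltn_ord (y k).
case: eqVneq => [->|_] /=; last case: eqVneq => [->|_] /=; move: yi yj;
 move: (nat_of_ord (y i)) (nat_of_ord (y j)) (nat_of_ord (y k)) => Y Y' Y''; clear; lia.
Qed.

Lemma sum_plaqs (F : cell -> R) :
  \sum_(q : bvert m N * 'I_m * 'I_m | bplaq_ok q.1.1 q.1.2 q.2)
     F (ofb q.1.1, [set q.1.2; q.2]%SET) = \sum_(c <- plaqs) F c.
Proof.
rewrite -big_filter.
apply/esym; apply: (sum_reindex_seq (h := fun q => (ofb q.1.1, [set q.1.2; q.2]%SET))).
- exact/filter_uniq/index_enum_uniq.
- exact: fset_uniq.
- move=> [[y i] j] [[y' i'] j']; rewrite !mem_filter /= => /andP[/and3P[ij _ _] _].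
  case/andP=> /and3P[ij' _ _] _ [ey eE].
  have -> : y = y' by rewrite -[y]ofbK ey ofbK.
  have hi : i \in [set i'; j']%SET by rewrite -eE !inE eqxx.
  have hj : j \in [set i'; j']%SET by rewrite -eE !inE eqxx orbT.
  move: hi hj ij ij'; rewrite !inE => /orP[]/eqP -> /orP[]/eqP -> //; rewrite ?ltnn //.
  by move=> h /(ltn_trans h); rewrite ltnn.
move=> c; rewrite in_plaqs; apply/idP/mapP => [/andP[/cards2P[i [j [ij e]]] bc]|[q]].
  wlog lij : i j ij e / (i < j)%N.
    move=> H; have [h|h|h] := ltngtP i j; first exact: (H i j).
      by apply: (H j i) => //; [rewrite eq_sym|rewrite e finset.setUC].
    by move/eqP: ij; case; apply: val_inj.
  have ev := tobK (box_inbox bc); exists (tob c.1, i, j); last first.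
    by rewrite /= ev -e -surjective_pairing.
  rewrite mem_filter mem_index_enum andbT /= /bplaq_ok lij /= -bplaq_box //.
  by rewrite ev -e -surjective_pairing.
case: q => [[y i] j]; rewrite mem_filter /= => /andP[/and3P[ij yi yj] _] -> /=.
have ij' : i != j by apply: contraTneq ij => ->; rewrite ltnn.
by rewrite bplaq_box // yi yj cards2 ij'.
Qed.

(** Each plaquette counts once per orientation, and nonzero curvature turns its 2 into -2: this is
    where the activity [exp(-4 beta)] comes from. *)
Lemma action_curv sigma : action sigma = 2 * #|` plaqs|%:R - 4 * #|` curv sigma|%:R :> R.
Proof.
rewrite /action.
transitivity (\sum_(q : bvert m N * 'I_m * 'I_m | bplaq_ok q.1.1 q.1.2 q.2)
   \sum_(o : bool) rho (R := R) (dsig sigma q.1.1 q.1.2 q.2)).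
  by rewrite pair_big_dep /=; apply: eq_bigl => q; rewrite andbT.
rewrite (eq_bigr (fun q => 2 * rho (R := R) (d1 (edgef sigma) (ofb q.1.1, [set q.1.2; q.2]%SET)))).
  rewrite (sum_plaqs (fun c => 2 * rho (d1 (edgef sigma) c))) -big_distrr /=.
  have -> : #|` curv sigma|%:R = \sum_(c <- plaqs) (if d1 (edgef sigma) c then 1 else 0) :> R.
    rewrite -big_mkcond /= -big_filter big_const_seq count_predT iter_addr_0.
    congr (_%:R); apply: perm_size; apply: uniq_perm; rewrite ?filter_uniq ?fset_uniq //.
    by move=> c; rewrite mem_filter in_curv andbC.
  have -> : #|` plaqs|%:R = \sum_(c <- plaqs) 1 :> R.
    by rewrite big_const_seq count_predT iter_addr_0.
  rewrite !big_distrr /= -sumrB; apply: eq_bigr => c _; rewrite /rho.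
  by case: (d1 _ _); ring.
by move=> q ok; rewrite dsig_d1 // sumr_const card_bool mulr_natl.
Qed.

Lemma curv_admissible sigma : admissible (box N) (curv sigma).
Proof.
apply/admissibleP; split=> [p|c c3 bc].
  by rewrite in_curv in_plaqs => /andP[/andP[/eqP -> ->]].
rewrite -(dcell_d1 (edgef sigma) c3); apply: (dcell_box c3 bc) => q q2 bq.
by rewrite [LHS]in_curv in_plaqs q2 bq.
Qed.

Definition cadd sigma tau : bconf m N := [ffun e => sigma e (+) tau e].

Lemma in_curvD sigma tau c :
  (c \in curv (cadd sigma tau)) = (c \in curv sigma) (+) (c \in curv tau).
Proof.
rewrite !in_curv.
have -> : d1 (edgef (cadd sigma tau)) c = d1 (edgef sigma) c (+) d1 (edgef tau) c.
  rewrite -d1_add; apply: eq_bigr => i _; rewrite /edgef ffunE.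
  by congr (_ (+) _); apply: eq_bigr => j _; rewrite ffunE.
by case: (_ \in plaqs).
Qed.

Lemma curv_surj om : admissible (box N) om -> exists2 sigma, bconf_ok sigma & curv sigma = om.
Proof.
move=> /admissibleP[H1 H2]; have [s Hs] := poincare H2.
pose sigma : bconf m N := [ffun e => bedge_ok e && s (ofb e.1) e.2].
exists sigma; first by apply/forallP => e; apply/implyP => /negPf h; rewrite ffunE h.
have edge v k : inbox v -> v k + 1 <= N%:Z -> edgef sigma v k = s v k.
  move=> iv vk; rewrite /edgef ffunE /= tobK // /bedge_ok /=; have [h1 h2] := iv k.
  rewrite tobE //; have -> // : (`|(v k + N%:Z)%R| < 2 * N)%N.
  by move: (v k) h1 vk => V; clear; lia.
have key c : #|c.2| = 2%N -> box N c -> d1 (edgef sigma) c = d1 s c.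
  case: c => v E /= /eqP/cards2P[i [j [ij ->]]] bc; rewrite !d1_pair //.
  have si : [set i]%SET \subset [set i; j]%SET by rewrite finset.sub1set !inE eqxx.
  have sj : [set j]%SET \subset [set i; j]%SET by rewrite finset.sub1set !inE eqxx orbT.
  have bi := box_sub si bc; have bj := box_sub sj bc.
  have bij : box N (v + ev i, [set j]%SET).
    by apply: box_shift sj _ _ bc; rewrite !inE ?eqxx.
  have bji : box N (v + ev j, [set i]%SET).
    by apply: box_shift si _ _ bc; rewrite !inE ?eqxx ?orbT // eq_sym.
  have last w k : box N (w, [set k]%SET) -> edgef sigma w k = s w k.
    move=> bw; apply: edge; first exact: box_inbox bw.
    by move/boxP: bw => /(_ k) [_]; rewrite /= inE eqxx.
  by rewrite !last.
apply/fsetP => c; rewrite in_curv in_plaqs; apply/andP/idP => [[/andP[/eqP c2 bc]]|com].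
  by rewrite key // Hs.
by have [c2 bc] := H1 c com; rewrite key // Hs // c2 bc.
Qed.

(** Curvature is additive and, by [curv_surj], onto the admissible sets; its fibres are translates
    of the set of flat configurations, whose number is [C]. *)
Lemma sum_conf : exists2 C : R, 0 < C &
  forall F : {fset cell} -> R, \sum_(sigma : bconf m N | bconf_ok sigma) F (curv sigma) =
    C * \sum_(om <- fpowerset plaqs | admissible (box N) om) F om.
Proof.
pose C : R := \sum_(sigma : bconf m N | bconf_ok sigma && (curv sigma == fset0)) 1.
exists C.
  rewrite /C (bigD1 [ffun=> false]) /=; last first.
    apply/andP; split; first by apply/forallP => e; rewrite ffunE implybT.
    apply/eqP/fsetP => c; rewrite in_curv; apply/andP => -[_].
    rewrite /d1 big1 // => i _; rewrite /edgef ffunE big1 // => j _; by rewrite ffunE.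
  by apply: ltr_pwDl => //; apply: sumr_ge0.
move=> F; rewrite -[X in C * X]big_filter.
set s := [seq om <- _ | _]; have us : uniq s by apply/filter_uniq/fset_uniq.
transitivity (\sum_(sigma : bconf m N | bconf_ok sigma)
    \sum_(om <- s) (if curv sigma == om then F om else 0)).
  apply: eq_bigr => sigma _.
  rewrite (eq_bigr (fun om => if curv sigma == om then F (curv sigma) else 0)); last first.
    by move=> om _; case: eqP => [->|].
  rewrite sum_if_eq //; have -> // : curv sigma \in s.
  rewrite mem_filter; apply/andP; split; first exact: curv_admissible.
  by rewrite fpowersetE; apply/fsubsetP => c; rewrite in_curv => /andP[].
rewrite exchange_big big_distrr /= big_seq [RHS]big_seq; apply: eq_bigr => om.
rewrite mem_filter => /andP[/curv_surj[tau tok ctau] _].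
rewrite -big_mkcondr /=.
rewrite (eq_bigr (fun=> 1 * F om)) => [|? _]; last by rewrite mul1r.
rewrite -big_distrl /=; congr (_ * _); rewrite /C.
have caddK : involutive (cadd^~ tau).
  by move=> sigma; apply/ffunP => e; rewrite !ffunE addbK.
rewrite (reindex_inj (inv_inj caddK)) /=; apply: eq_bigl => sigma; congr (_ && _).
  apply/forallP/forallP => H e; apply/implyP => ne; have := H e;
    rewrite ?ffunE; have := forallP tok e; rewrite ne /= => /negPf ->; rewrite addbF //.
apply/eqP/eqP => H; apply/fsetP => c.
  by have := congr1 (fun X : {fset cell} => c \in X) H; rewrite in_curvD ctau -[RHS]addFb => /addIb.
by rewrite in_curvD ctau H.
Qed.

Definition ofz (a : zvert m) : vert := [ffun k => a k].

Lemma to_box_edge (a : zvert m) (n : nat) i :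
  to_box N (zadd a (zscale n (zunit i))) = tob (ofz a + ev i *+ n).
Proof.
apply/ffunP => k; rewrite [LHS]ffunE [RHS]ffunE /= vaddE evnE ffunE /zadd /zscale /zunit.
by rewrite PoszM mulrC.
Qed.

Lemma to_box_edge2 (a : zvert m) (n n' : nat) i j :
  to_box N (zadd (zadd a (zscale n (zunit i))) (zscale n' (zunit j))) =
  tob (ofz a + ev i *+ n + ev j *+ n').
Proof.
rewrite to_box_edge; congr tob; congr (_ + _); apply/ffunP => k.
by rewrite vaddE evnE !ffunE /zadd /zscale /zunit PoszM mulrC.
Qed.

(** Stokes' theorem mod 2: an edge shared by two plaquettes of the rectangle occurs twice, and the
    product telescopes to the boundary. *)
Lemma wilson_curv sigma i j (a : zvert m) Rl T : i != j ->
  (forall p, p \in rect i j (ofz a) Rl T -> box N p) ->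
  wilson (rect_edges i j a Rl T) sigma = sgn R (rect i j (ofz a) Rl T) (curv sigma).
Proof.
move=> ij inb; set b := ofz a; pose e v k := edgef sigma v k.
have e1 : sgn R (rect i j b Rl T) (curv sigma) = \prod_(0 <= u < Rl) \prod_(0 <= v < T)
   (sgp R (e (b + ev i *+ u + ev j *+ v) i (+) e (b + ev i *+ u + ev j *+ v.+1) i) *
    sgp R (e (b + ev i *+ u + ev j *+ v) j (+) e (b + ev i *+ u.+1 + ev j *+ v) j)).
  rewrite sgn_rect big_nat [RHS]big_nat; apply: eq_bigr => u /andP[_ uR].
  rewrite big_nat [RHS]big_nat; apply: eq_bigr => v /andP[_ vT].
  rewrite in_curv in_plaqs cards2 ij inb /=; last by apply/rectP; exists u, v.
  rewrite d1_pair // -sgpM; congr sgp.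
  rewrite !mulrSr !addrA (addrAC _ (ev i) (ev j *+ v)) -/b /e.
  by do 4 case: (edgef _ _ _).
rewrite e1; under eq_bigr do rewrite big_split /=.
rewrite big_split /=; under eq_bigr => u _ do
  rewrite (prod_telescope_sgp R (fun v : nat => e (b + ev i *+ u + ev j *+ v) i)) mulr0n addr0.
rewrite exchange_big /=; under [X in _ * X]eq_bigr => v _ do
  rewrite (prod_telescope_sgp R (fun u => e (b + ev i *+ u + ev j *+ v) j)) mulr0n addr0.
rewrite !big_split /= /wilson /rect_edges !big_cat /= !big_map /= /index_iota !subn0 -!mulrA.
congr (_ * (_ * (_ * _))); apply: eq_bigr => u _; rewrite ?to_box_edge2 ?to_box_edge //.
by rewrite /e /edgef addrAC.
Qed.

Lemma expect_wilson (beta : R) i j (a : zvert m) Rl T : i != j ->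
  (forall p, p \in rect i j (ofz a) Rl T -> box N p) ->
  let x := expR (- (4 * beta)) in
  expect (N := N) beta (wilson (rect_edges i j a Rl T)) =
  psum (wt x (box N) (rect i j (ofz a) Rl T)) plaqs / psum (wt x (box N) [::]) plaqs.
Proof.
move=> ij inb x; have [C C0 HC] := sum_conf; set l := rect _ _ _ _ _.
pose E0 := expR (beta * (2 * #|` plaqs|%:R)).
have gw sigma : gibbs_weight beta sigma = E0 * x ^+ #|` curv sigma|.
  rewrite /gibbs_weight action_curv mulrBr expRD /E0 /x -expRM_natr; congr (_ * expR _).
  by ring.
have P l' : \sum_(sigma : bconf m N | bconf_ok sigma) sgn R l' (curv sigma) * gibbs_weight beta sigma =
    C * E0 * psum (wt x (box N) l') plaqs.
  rewrite (eq_bigr (fun sigma => sgn R l' (curv sigma) * (E0 * x ^+ #|` curv sigma|))).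
    rewrite (HC (fun om => sgn R l' om * (E0 * x ^+ #|` om|))) -mulrA; congr (_ * _).
    rewrite /psum big_mkcond big_distrr; apply: eq_bigr => om _ /=; rewrite /wt.
    by case: ifP => _; [ring|rewrite mulr0].
  by move=> sigma _; rewrite gw.
rewrite /expect (eq_bigr (fun sigma => sgn R l (curv sigma) * gibbs_weight beta sigma)).
  rewrite [X in _ / X](eq_bigr (fun sigma => sgn R [::] (curv sigma) * gibbs_weight beta sigma)).
    rewrite !P -mulf_div divff ?mul1r // mulf_neq0 ?gt_eqF //.
    exact: expR_gt0.
  by move=> sigma _; rewrite /sgn big_nil mul1r.
by move=> sigma _; rewrite wilson_curv.
Qed.

Lemma hosts_plaqs : hosts (box N) plaqs.
Proof. by move=> p p2 bp; rewrite in_plaqs p2 bp. Qed.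

End Box.

Local Open Scope classical_set_scope.
Local Open Scope ring_scope.

(** * From second differences to the perimeter law *)

Section Limits.
Variable R : realType.
Implicit Types (u : nat -> R) (a b c e l q K : R).

Lemma cvgn_eps u l :
  (forall e, 0 < e -> exists M : nat, forall n, (M <= n)%N -> `|u n - l| <= e) ->
  u @ \oo --> l.
Proof.
move=> H; apply/cvgrPdist_le => e e0; have [M HM] := H e e0.
by exists M => // n /= /HM; rewrite distrC.
Qed.

Lemma cvgn_near u l e : u @ \oo --> l -> 0 < e ->
  exists M : nat, forall n, (M <= n)%N -> `|u n - l| <= e.
Proof.
move=> /cvgrPdist_le H e0; have [M _ HM] := H e e0.
by exists M => n Mn; rewrite distrC; apply: HM.
Qed.

Lemma cauchy_cvgn u :
  (forall e, 0 < e -> exists M : nat, forall n n', (M <= n)%N -> (M <= n')%N ->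
     `|u n - u n'| <= e) -> exists l, u @ \oo --> l.
Proof.
move=> H; suff : cvgn u by move=> h; exists (limn u).
apply/cauchy_cvgP/cauchy_exP => e e0; have e2 : 0 < e / 2 by rewrite divr_gt0.
have [M HM] := H _ e2.
exists (u M); exists M => // n /= Mn; rewrite /ball /= distrC.
by apply: le_lt_trans (HM n M Mn (leqnn _)) _; rewrite ltr_pdivrMr // ltr_pMr // ltr1n.
Qed.

Lemma dist_limn u l a b (M : nat) : u @ \oo --> l ->
  (forall n, (M <= n)%N -> `|u n - a| <= b) -> `|l - a| <= b.
Proof.
move=> ul H; apply/ler_addgt0Pr => e e0; have [M' HM'] := cvgn_near ul e0.
have h1 := H (maxn M M') (leq_maxl _ _); have h2 := HM' (maxn M M') (leq_maxr _ _).
rewrite (_ : l - a = - (u (maxn M M') - l) + (u (maxn M M') - a)); last by ring.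
by apply: le_trans (ler_normD _ _) _; rewrite normrN addrC lerD.
Qed.

Lemma le0_of_natmul a c : (forall n : nat, n%:R * a <= c) -> a <= 0.
Proof.
move=> H; rewrite leNgt; apply/negP => a0.
have := H (Num.truncn (c / a)).+1; rewrite -ler_pdivlMr // leNgt.
by rewrite truncnS_gt.
Qed.

Variable q : R.
Hypotheses (q0 : 0 < q) (q1 : q < 1).

Lemma exp_small c e : 0 < e -> exists S : nat, forall n, (S <= n)%N -> c * q ^+ n <= e.
Proof.
move=> e0; have : c * q ^+ n @[n --> \oo] --> c * 0.
  by apply: cvgMr; apply: cvg_expr; rewrite ger0_norm // ltW.
move/cvgn_near => /(_ e e0) [S HS]; exists S => n /HS.
by rewrite mulr0 subr0 => /ler_normlP[].
Qed.

Lemma geom_sum_le (S n : nat) : \sum_(S <= k < n) q ^+ k <= q ^+ S / (1 - q).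
Proof.
have q1' : 0 < 1 - q by rewrite subr_gt0.
case: (leqP S n) => Sn; last first.
  by rewrite big_geq ?(ltnW Sn) // divr_ge0 ?exprn_ge0 ?(ltW q0) // ltW.
suff -> : \sum_(S <= k < n) q ^+ k = (q ^+ S - q ^+ n) / (1 - q).
  by rewrite ler_pM2r ?invr_gt0 // gerBl exprn_ge0 // ltW.
rewrite -(subnKC Sn); elim: (n - S)%N => [|d IH].
  by rewrite addn0 big_geq // subrr mul0r.
rewrite addnS big_nat_recr ?leq_addr //= IH exprS; field.
by rewrite gt_eqF.
Qed.

Lemma geom_cauchy u K : 0 <= K -> (forall n, `|u n.+1 - u n| <= K * q ^+ n) ->
  exists l, forall n, `|u n - l| <= K / (1 - q) * q ^+ n.
Proof.
move=> K0 H; have q1' : 0 < 1 - q by rewrite subr_gt0.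
have D n n' : (n <= n')%N -> `|u n' - u n| <= K / (1 - q) * q ^+ n.
  move=> nn'; rewrite -telescope_sumr //; apply: le_trans (ler_norm_sum _ _ _) _.
  apply: (@le_trans _ _ (\sum_(n <= k < n') K * q ^+ k)); first exact: ler_sum.
  by rewrite -big_distrr /= mulrAC -mulrA ler_wpM2l // geom_sum_le.
have [|l ul] := @cauchy_cvgn u.
  move=> e e0; have [S HS] := exp_small (K / (1 - q)) e0; exists S => n n' Sn Sn'.
  wlog nn' : n n' Sn Sn' / (n <= n')%N.
    by move=> W; case/orP: (leq_total n n') => h; [|rewrite distrC]; apply: W.
  by rewrite distrC; apply: le_trans (D _ _ nn') (HS _ Sn).
exists l => n; rewrite distrC; exact: dist_limn ul (D n).
Qed.

End Limits.

(** * The perimeter law for symmetric functions with small second differences *)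

Section PerimeterAsymptotics.
Variables (R : realType) (q K : R) (f : nat -> nat -> R).
Hypotheses (q0 : 0 < q) (q1 : q < 1) (K0 : 0 <= K).
Hypothesis fC : forall a b, f a b = f b a.
Hypothesis f_le : forall a b, `|f a b| <= K * (a + b)%:R.
Hypothesis f_diff2 : forall a b,
  `|f a b.+2 + f a b - (f a b.+1 + f a b.+1)| <= K * a%:R * q ^+ b.

Let q1' : 0 < 1 - q. Proof. by rewrite subr_gt0. Qed.
Let K1 := K / (1 - q).
Let K2 := K1 / (1 - q).
Let K10 : 0 <= K1. Proof. by rewrite divr_ge0 // ltW. Qed.
Let K20 : 0 <= K2. Proof. by rewrite divr_ge0 // ltW. Qed.

Lemma slope_exists : exists VR : nat -> R, forall a b,
  `|(f a b.+1 - f a b) - VR a| <= K1 * a%:R * q ^+ b.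
Proof.
suff H a : exists V, forall b, `|(f a b.+1 - f a b) - V| <= K1 * a%:R * q ^+ b.
  by have [VR] := choice H; exists VR.
have [|n|V HV] := @geom_cauchy _ q q0 q1 (fun b => f a b.+1 - f a b) (K * a%:R).
- by rewrite mulr_ge0.
- apply: le_trans (f_diff2 a n); rewrite le_eqVlt; apply/orP; left; apply/eqP.
  by congr `|_|; ring.
by exists V => b; rewrite /K1 [K / _ * _]mulrAC; apply: HV.
Qed.

Theorem perimeter_asymptotics : exists (V : R) (VR : nat -> R),
  [/\ forall a, (fun b : nat => f a b / b%:R) @ \oo --> VR a,
      VR @ \oo --> V &
      forall r t : nat, (0 < r)%N -> (0 < t)%N ->
       (fun n : nat => f (r * n) (t * n) / (r * n + t * n)%:R) @ \oo --> V].
Proof.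
have [VR HVR] := slope_exists.
have E1 a b0 b : (b0 <= b)%N ->
    `|f a b - f a b0 - (b - b0)%:R * VR a| <= K2 * a%:R * q ^+ b0.
  move=> bb.
  have -> : f a b - f a b0 - (b - b0)%:R * VR a =
      \sum_(b0 <= k < b) ((f a k.+1 - f a k) - VR a).
    by rewrite sumrB telescope_sumr // sumr_const_nat mulr_natl.
  apply: le_trans (ler_norm_sum _ _ _) _.
  apply: (@le_trans _ _ (\sum_(b0 <= k < b) K1 * a%:R * q ^+ k)); first exact: ler_sum.
  have -> : K2 * a%:R * q ^+ b0 = K1 * a%:R * (q ^+ b0 / (1 - q)) by rewrite /K2; ring.
  by rewrite -big_distrr /=; apply: ler_wpM2l (geom_sum_le q0 q1 _ _); rewrite mulr_ge0.
pose C a := (K + K2) * a%:R.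
have C0 a : 0 <= C a by rewrite mulr_ge0 ?addr_ge0.
have E2 a b : `|f a b - b%:R * VR a| <= C a.
  have := E1 a 0%N b (leq0n b); rewrite subn0 expr0 mulr1 => h.
  have := f_le a 0%N; rewrite addn0 => h'.
  rewrite (_ : f a b - b%:R * VR a = f a 0%N + (f a b - f a 0%N - b%:R * VR a)); last by ring.
  by apply: le_trans (ler_normD _ _) _; rewrite /C mulrDl lerD.
have VRle a : `|VR a| <= K.
  rewrite -subr_le0; apply: (@le0_of_natmul _ _ (C a + K * a%:R)) => n.
  have h := E2 a n; have h' := f_le a n.
  have : `|n%:R * VR a| <= C a + K * (a + n)%:R.
    rewrite (_ : n%:R * VR a = - (f a n - n%:R * VR a) + f a n); last by ring.
    by apply: le_trans (ler_normD _ _) _; rewrite normrN lerD.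
  by rewrite normrM ger0_norm // natrD => h''; lra.
(* Symmetry gives the second difference in the first variable too. Since [f a n] is [n * VR a] up to
   a constant, dividing by [n] and letting it grow transfers the bound to [VR]. *)
have V2 a : `|VR a.+2 + VR a - (VR a.+1 + VR a.+1)| <= K * q ^+ a.
  rewrite -subr_le0; apply: (@le0_of_natmul _ _ (C a.+2 + C a + (C a.+1 + C a.+1))) => n.
  have := f_diff2 n a; rewrite !(fC n) => h.
  have h0 := E2 a n; have h1 := E2 a.+1 n; have h2 := E2 a.+2 n.
  rewrite mulrBr -[X in X * `|_| - _]ger0_norm // -normrM.
  set A := f a n - _ in h0; set B := f a.+1 n - _ in h1; set D := f a.+2 n - _ in h2.
  rewrite (_ : n%:R * _ = (f a.+2 n + f a n - (f a.+1 n + f a.+1 n)) + (- D + - A + (B + B)));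
    last by rewrite /A /B /D; ring.
  have h3 : `|- D + - A + (B + B)| <= C a.+2 + C a + (C a.+1 + C a.+1).
    apply: le_trans (ler_normD _ _) _; apply: lerD.
      by apply: le_trans (ler_normD _ _) _; rewrite !normrN lerD.
    by apply: le_trans (ler_normD _ _) _; rewrite lerD.
  rewrite lerBlDr; apply: le_trans (ler_normD _ _) _.
  by rewrite addrC lerD // mulrA [n%:R * K]mulrC.
pose W a := VR a.+1 - VR a.
have [W0 HW] : exists l, forall n, `|W n - l| <= K / (1 - q) * q ^+ n.
  apply: geom_cauchy => // n; apply: le_trans (V2 n).
  by rewrite le_eqVlt; apply/orP; left; apply/eqP; congr `|_|; rewrite /W; ring.
have Wa a : `|W a| <= K1 * q ^+ a.
  (* A nonzero limit of the increments would make [VR] grow linearly, against [VRle]. *)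
  suff W00 : W0 = 0 by have := HW a; rewrite W00 subr0.
  apply/eqP; rewrite -normr_le0; apply: (@le0_of_natmul _ _ (K2 + 2 * K)) => n.
  have s1 : VR n - VR 0%N - n%:R * W0 = \sum_(0 <= k < n) (W k - W0).
    by rewrite sumrB telescope_sumr // sumr_const_nat subn0 mulr_natl.
  have s2 : `|VR n - VR 0%N - n%:R * W0| <= K2.
    rewrite s1; apply: le_trans (ler_norm_sum _ _ _) _.
    apply: (@le_trans _ _ (\sum_(0 <= k < n) K1 * q ^+ k)); first exact: ler_sum.
    rewrite -big_distrr /= /K2 ler_wpM2l //.
    by apply: le_trans (geom_sum_le q0 q1 _ _) _; rewrite expr0 mul1r.
  rewrite -[X in X * _]ger0_norm // -normrM.
  rewrite (_ : n%:R * W0 = - (VR n - VR 0%N - n%:R * W0) + (VR n - VR 0%N)); last by ring.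
  apply: le_trans (ler_normD _ _) _; rewrite normrN lerD //.
  by apply: le_trans (ler_normB _ _) _; rewrite mulr_natl mulr2n lerD.
have [V HV] : exists l, forall n, `|VR n - l| <= K1 / (1 - q) * q ^+ n.
  exact: geom_cauchy.
exists V, VR; split.
- move=> a; apply: cvgn_eps => e e0.
  exists (Num.truncn (C a / e)).+1 => b hb.
  have b0 : 0 < b%:R :> R by rewrite ltr0n; apply: leq_trans hb.
  have -> : f a b / b%:R - VR a = (f a b - b%:R * VR a) / b%:R by field; rewrite gt_eqF.
  rewrite normrM normfV (ger0_norm (ltW b0)) ler_pdivrMr //; apply: le_trans (E2 a b) _.
  rewrite mulrC -ler_pdivrMr //; apply: le_trans (ltW (truncnS_gt _)) _.
  by rewrite ler_nat.
- apply: cvgn_eps => e e0; have [S HS] := exp_small q0 q1 K2 e0.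
  by exists S => n /HS; apply: le_trans.
move=> r t r0 t0; apply: cvgn_eps => e e0.
have e4 : 0 < e / 4 by rewrite divr_gt0.
(* [S] is the cut height and depends on [e] only. Above it the slope is [VR A] with error at most
   [A * e / 4]; the slab below, read by symmetry as [f S A], has slope [VR S], already close to
   [V]. *)
have [S HS] := exp_small q0 q1 K2 e4.
have HSS := HS S (leqnn S).
pose c := C S + S%:R * K.
have c0 : 0 <= c by rewrite addr_ge0 // mulr_ge0.
exists (S + (Num.truncn (c / (e / 4))).+1)%N => n hn.
have nS : (S <= n)%N by apply: leq_trans hn; rewrite leq_addr.
have n0 : (0 < n)%N by apply: leq_trans hn; rewrite addnS.
have cn : c <= (r * n + t * n)%:R * (e / 4).
  rewrite -ler_pdivrMr //; apply: le_trans (ltW (truncnS_gt _)) _; rewrite ler_nat.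
  apply: leq_trans (leq_addl S _) _; apply: leq_trans hn _.
  by apply: leq_trans (leq_addr _ _); rewrite leq_pmull.
have Stn : (S <= t * n)%N by apply: leq_trans nS _; rewrite leq_pmull.
have nrn : (n <= r * n)%N by rewrite leq_pmull.
have h1 := E1 (r * n)%N S (t * n)%N Stn.
have h2 := E2 S (r * n)%N.
have h3 : `|VR S - V| <= e / 4 := le_trans (HV S) HSS.
have h4 : `|VR (r * n)%N - V| <= e / 4.
  by apply: le_trans (HV _) (HS _ _); apply: leq_trans nrn.
have h5 := VRle (r * n)%N.
set A := (r * n)%N in h1 h2 h4 h5 *; set B := (t * n)%N in h1 cn Stn *.
rewrite -/A in cn; have A0 : 0 < A%:R :> R by rewrite ltr0n; apply: leq_trans nrn.
have B0 : 0 <= B%:R :> R by [].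
have AB : 0 < (A + B)%:R :> R by rewrite natrD ltr_wpDr.
have -> : f A B / (A + B)%:R - V = (f A B - (A + B)%:R * V) / (A + B)%:R.
  by rewrite mulrBl [_ * V / _]mulrAC divff ?mul1r // gt_eqF.
rewrite normrM normfV (ger0_norm (ltW AB)) ler_pdivrMr //.
have h1' : `|f A B - f A S - (B - S)%:R * VR A| <= A%:R * (e / 4).
  by apply: le_trans h1 _; rewrite mulrAC mulrC ler_wpM2l.
have -> : f A B - (A + B)%:R * V =
   (f A B - f A S - (B - S)%:R * VR A) + (f S A - A%:R * VR S) + A%:R * (VR S - V) +
   B%:R * (VR A - V) - S%:R * VR A.
  by rewrite natrB // natrD (fC A S); ring.
have h3' : `|A%:R * (VR S - V)| <= A%:R * (e / 4).
  by rewrite normrM ger0_norm ?ler_wpM2l.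
have h4' : `|B%:R * (VR A - V)| <= B%:R * (e / 4).
  by rewrite normrM ger0_norm ?ler_wpM2l.
have h5' : `|S%:R * VR A| <= S%:R * K.
  by rewrite normrM ger0_norm ?ler_wpM2l.
apply: le_trans (ler_normB _ _) _; apply: le_trans (lerD (ler_normD _ _) h5') _.
apply: le_trans (lerD (lerD (ler_normD _ _) h4') (lexx _)) _.
apply: le_trans (lerD (lerD (lerD (ler_normD _ _) h3') (lexx _)) (lexx _)) _.
move: cn; rewrite /c natrD => cn.
have Be := mulr_ge0 B0 (ltW e4); have Ae := mulr_ge0 (ltW A0) (ltW e4).
move: h1' h2 cn Be Ae; clear; lra.
Qed.

End PerimeterAsymptotics.

(** * Infinite volume *)

Section InfiniteVolume.
Variables (R : realType) (m : nat) (x s t : R).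
Hypotheses (m3 : (2 < m)%N) (x0 : 0 <= x) (s1 : 1 < s) (t0 : 0 <= t) (t1 : t < 1).
Hypothesis xst : x * s * ((1 + t) / (1 - t)) ^+ (12 * (m - 2)) <= t.
Local Notation cell := (cell m).
Local Notation vert := (vert m).
Implicit Types (i j k : 'I_m) (a b : vert) (c p : cell) (N n : nat).

Let c0 := t / (1 - t).
Let c00 : 0 <= c0. Proof. by rewrite divr_ge0 // subr_ge0 ltW. Qed.
Let s0 : 0 < s. Proof. exact: lt_trans s1. Qed.
Let q := s^-1.
Let q0 : 0 < q. Proof. by rewrite invr_gt0. Qed.
Let q1 : q < 1. Proof. by rewrite invf_lt1. Qed.

Definition vrad a : nat := \max_k `|a k|%N.

Lemma vradP a k : (`|a k| <= vrad a)%N.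
Proof. exact: (leq_bigmax k). Qed.

Lemma box_rad N c : (forall k, (`|c.1 k| < N)%N) -> box N c.
Proof.
move=> H; apply/boxP => k; have := H k; move: (c.1 k) => C.
by case: (k \in c.2) => /=; clear; lia.
Qed.

Lemma rect_rad i j a Rl T p k : p \in rect i j a Rl T ->
  (`|p.1 k| <= vrad a + Rl + T)%N.
Proof.
case/rectP => u [v [uR vT ->]] /=; rewrite !vertE; have := vradP a k.
move: (a k) uR vT (vrad a) => A; case: (k == i); case: (k == j); clear; lia.
Qed.

Lemma near_rect_box i j a Rl T n N p c : (vrad a + Rl + T + n < N)%N ->
  p \in rect i j a Rl T -> (forall k, (`|c.1 k - p.1 k| <= n)%N) -> box N c.
Proof.
move=> hN pr H; apply: box_rad => k; have := H k; have := rect_rad k pr.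
move: (c.1 k) (p.1 k) (vrad a) hN => C P V; clear; lia.
Qed.

Definition lrN i j a (Rl T N : nat) : R := lr x (box N) (plaqs m N) (rect i j a Rl T).

Lemma lrN_local i j a Rl T n N N' :
  (vrad a + Rl + T + n < N)%N -> (vrad a + Rl + T + n < N')%N ->
  `|lrN i j a Rl T N - lrN i j a Rl T N'| <= 4 * c0 * (Rl * T)%:R * q ^+ n.
Proof.
move=> hN hN'; rewrite exprVn -(size_rect i j a).
apply: (lr_local m3 x0 s1 t0 t1 xst (@hosts_plaqs m N) (@hosts_plaqs m N')).
by move=> p c pr H; split; apply: near_rect_box pr H.
Qed.

Lemma lrN_cvg i j a Rl T : lrN i j a Rl T @ \oo --> limn (lrN i j a Rl T).
Proof.
have [|l ul] := @cauchy_cvgn _ (lrN i j a Rl T); last by rewrite (cvg_lim _ ul).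
move=> e e0; have [S HS] := exp_small q0 q1 (4 * c0 * (Rl * T)%:R) e0.
exists (vrad a + Rl + T + S).+1 => N N' hN hN'.
exact: le_trans (lrN_local _ _ hN hN') (HS S (leqnn S)).
Qed.

Definition free i j a (Rl T : nat) : R := - limn (lrN i j a Rl T).

Lemma eq_limn_dist (u v : nat -> R) : cvgn u -> cvgn v ->
  (forall e, 0 < e -> exists M : nat, forall n, (M <= n)%N -> `|u n - v n| <= e) ->
  limn u = limn v.
Proof.
move=> cu cv H; apply/eqP; rewrite -subr_eq0 -normr_le0; apply/ler_addgt0Pr => e e0.
have [M HM] := H e e0; rewrite add0r -[_ - _]subr0.
apply: (@dist_limn _ (fun n => u n - v n) _ _ _ M); first exact: cvgB.
by move=> n /HM; rewrite subr0.
Qed.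

(** The symmetry turns the box into another region around the image rectangle, and [lr_local] shows
    that this region and the box have the same limit. *)
Lemma free_perm (pi : {perm 'I_m}) b i j a Rl T :
  free (pi i) (pi j) (tauv pi b a) Rl T = free i j a Rl T.
Proof.
congr (- _); apply: eq_limn_dist; [exact: lrN_cvg|exact: lrN_cvg|move=> e e0].
have [S HS] := exp_small q0 q1 (4 * c0 * (Rl * T)%:R) e0.
set a' := tauv pi b a.
(* The margin [vrad b] makes the translated box contain the neighbourhood as well. *)
exists (vrad a' + Rl + T + S + vrad b).+1 => N hN.
pose Lam' : pred cell := fun c => `[< exists2 c', c = tauc pi b c' & box N c' >].
have LL c : Lam' (tauc pi b c) = box N c.
  by apply/asboolP/idP => [[c' /tauc_inj ->]|bc] //; exists c.
rewrite distrC /lrN -(@lr_tauc R m x pi b (box N) Lam' (rect i j a Rl T) (plaqs m N) LL) map_tauc_rect -/a'.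
apply: le_trans (HS S (leqnn S)); rewrite exprVn -(size_rect (pi i) (pi j) a').
have hL : hosts Lam' (tauc pi b @` plaqs m N)%fset.
  move=> p p2 /asboolP[c' e' bc']; rewrite e'; apply/imfsetP; exists c' => //=.
  rewrite in_plaqs bc' andbT -p2 e' /= card_imset //; exact: perm_inj.
apply: (lr_local m3 x0 s1 t0 t1 xst hL (@hosts_plaqs m N)).
move=> p c pr H; split; last first.
  by apply: near_rect_box pr H; apply: leq_ltn_trans (leq_addr (vrad b) _) _.
apply/asboolP; have [c' e'] := tauc_surj pi b c; exists c' => //.
apply: box_rad => k; have := H (pi k); have := rect_rad (pi k) pr; have := vradP b (pi k).
rewrite e' /= ffunE permK.
move: (c'.1 k) (p.1 (pi k)) (b (pi k)) (vrad a') (vrad b) hN => C P B A B'; clear; lia.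
Qed.

Lemma free_inv i j a i' j' a' Rl T : i != j -> i' != j' ->
  free i j a Rl T = free i' j' a' Rl T.
Proof.
move=> ij ij'.
(* The second transposition sends the image of [j] to [j'] and leaves [i'] fixed. *)
pose pi := (tperm i i' * tperm (tperm i i' j) j')%g.
have pj : pi j = j' by rewrite permM tpermL.
have pii : pi i = i'.
  rewrite permM tpermL tpermD //; last by rewrite eq_sym.
  by rewrite -[X in _ != X](tpermL i i') (inj_eq perm_inj) eq_sym.
rewrite -(free_perm pi [ffun l => a' l - a (pi^-1 l)%g] i j a Rl T) pj pii.
suff -> : tauv pi [ffun l => a' l - a (pi^-1 l)%g] a = a' by [].
by apply/ffunP => l; rewrite !ffunE subrKC.
Qed.

Lemma free_swap i j a Rl T : free i j a Rl T = free j i a T Rl.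
Proof.
congr (- limn _); apply/funext => N; rewrite /lrN /lr; congr (ln _ - _).
apply: eq_bigr => om _; apply: eq_wt_sgn => _; exact: sgn_rect_swap.
Qed.

Lemma free_diff2 i j a Rl T : i != j ->
  `|free i j a Rl T.+2 + free i j a Rl T - (free i j a Rl T.+1 + free i j a Rl T.+1)| <=
  4 * c0 * Rl%:R * q ^+ T.
Proof.
move=> ij; rewrite [X in _ + X - _](free_inv a (a + ev j) Rl T ij ij).
rewrite [X in _ - (_ + X)](free_inv a (a + ev j) Rl T.+1 ij ij) /free.
have alg (A B C D : R) : - A - B - (- C - D) = - (A + B - (C + D)) by ring.
rewrite alg normrN exprVn.
rewrite -[X in `|X|]subr0; apply: (@dist_limn _ (fun N =>
   lrN i j a Rl T.+2 N + lrN i j (a + ev j) Rl T N -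
   (lrN i j a Rl T.+1 N + lrN i j (a + ev j) Rl T.+1 N)) _ _ _ 0).
  apply: cvgB; apply: cvgD; exact: lrN_cvg.
move=> N _; rewrite subr0; exact: (lr_second_diff m3 x0 s1 t0 t1 xst).
Qed.

Lemma third_direction i j : exists k, i != k /\ j != k.
Proof.
have /card_gt0P[k] : (0 < #|~: [set i; j]%SET|)%N.
  by rewrite cardsCs finset.setCK card_ord cards2; case: (i != j) => /=; lia.
by rewrite !inE negb_or ![k == _]eq_sym => /andP[]; exists k.
Qed.

(** In infinite volume a box of any height fits above the rectangle, so the contribution of the lid
    can be made smaller than any [e]. *)
Lemma free_perimeter i j a Rl T : i != j ->
  `|free i j a Rl T| <= 2 * c0 * (2 * (s / (s - 1))) * (Rl + T)%:R.
Proof.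
move=> ij; have [k [ik jk]] := third_direction i j.
suff H (e : R) : 0 < e ->
    `|free i j a Rl T| <= 2 * c0 * (2 * (s / (s - 1))) * (Rl + T)%:R + e.
  by apply/ler_addgt0Pr.
move=> e0; have [h Hh] := exp_small q0 q1 (2 * c0 * (Rl * T)%:R) e0.
rewrite /free normrN -[X in `|X|]subr0.
have D := @dist_limn R (lrN i j a Rl T) (limn (lrN i j a Rl T)) 0
  (2 * c0 * (2 * (s / (s - 1))) * (Rl + T)%:R + e) (vrad a + Rl + T + h).+1
  (@lrN_cvg i j a Rl T).
apply: D => N hN.
have slab u v z : (u < Rl)%N -> (v < T)%N -> (z < h)%N ->
    box N (a + ev i *+ u + ev j *+ v + ev k *+ z, [set i; j; k]%SET).
  move=> uR vT zh; apply: box_rad => w /=; rewrite !vertE; have := vradP a w.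
  move: (a w) (vrad a) hN uR vT zh => A V.
  by case: (w == i); case: (w == j); case: (w == k); clear; lia.
have := @lr_perimeter R m x s t m3 x0 s1 t0 t1 xst _ (plaqs m N) i j k a Rl T h ij ik jk slab.
rewrite subr0 => /le_trans; apply.
rewrite mulrDr addrC; apply: lerD; first by rewrite mulrA.
by have := Hh h (leqnn h); rewrite /q exprVn [X in _ -> X <= _]mulrA.
Qed.

Lemma ln_rect_wilson (beta : R) i j (a : zvert m) Rl T : x = expR (- (4 * beta)) -> i != j ->
  - ln (rect_wilson beta i j a Rl T) = free i j (ofz a) Rl T.
Proof.
move=> xE ij; congr (- _); rewrite -[RHS]expRK; congr ln.
set u := lrN i j (ofz a) Rl T.
have h : (fun N => expR (u N)) @ \oo --> expR (limn u).
  by apply: continuous_cvg; [exact: continuous_expR|exact: lrN_cvg].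
(* The expectation is the exponential of [lrN] once the box contains the rectangle; smaller boxes,
   where [to_box] may return default values, do not affect the limit. *)
apply: cvg_lim => //; apply: cvgn_eps => e e0; have [M HM] := cvgn_near h e0.
exists (maxn M (vrad (ofz a) + Rl + T).+1) => N; rewrite geq_max => /andP[hM hN].
rewrite expect_wilson //; last first.
  move=> p pr; apply: (@near_rect_box i j (ofz a) Rl T 0 N p p _ pr).
    by rewrite addn0.
  by move=> k; rewrite subrr.
rewrite -xE; have := HM N hM; rewrite /u /lrN /lr expRB !lnK //;
  by rewrite posrE; apply: (psum_wt_gt0 m3 x0 s1 t0 t1 xst).
Qed.

End InfiniteVolume.

(** * The numerical threshold *)

Section Constants.
Variable R : realType.

(** Fourth power of the inverse of [exp(-1/4) >= 3/4]. *)
Lemma expR1_le : expR 1 <= (4 / 3) ^+ 4 :> R.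
Proof.
have -> : 1 = - (- (4%:R^-1)) * 4%:R :> R by field.
rewrite expRM_natr lerXn2r ?nnegrE ?expR_ge0 // expRN.
rewrite -[leRHS]invrK lef_pV2 ?posrE ?expR_gt0 //.
by apply: le_trans (expR_ge1Dx _); lra.
Qed.

(** With [M = m - 2], the exponent [12 M] is the inverse of [3 t], and
    [(1 + t) / (1 - t) <= 1 + 3 t <= exp(3 t)], so the power is at most e. The threshold gives
    activity at most [(100 M^2)^-1 exp(-2/3)], with [exp(-2/3) <= 3/5]. What remains is
    [(3/5) (4/3)^5 <= 100/36]. *)
Lemma polymer_constants (m : nat) (beta : R) : (3 <= m)%N ->
  ln (10 * (m - 2)%:R) / 2 + 6^-1 < beta ->
  let t := (36 * (m - 2)%:R)^-1 in
  [/\ 0 <= t, t < 1 &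
    expR (- (4 * beta)) * (4 / 3) * ((1 + t) / (1 - t)) ^+ (12 * (m - 2)) <= t].
Proof.
move=> m3; set M : R := (m - 2)%:R => hb /=; set t := (36 * M)^-1.
have M1 : 1 <= M by rewrite ler1n; lia.
have t0 : 0 < t by rewrite invr_gt0; lra.
have t3 : t <= 36^-1 by rewrite lef_pV2 ?posrE; lra.
have D0 : (0 < 12 * (m - 2))%N by lia.
split; [exact: ltW|lra|].
have hx : expR (- (4 * beta)) <= (100 * M ^+ 2)^-1 * (3 / 5).
  apply: (@le_trans _ _ (expR (- (ln (10 * M) * 2%:R) + - (2 / 3)))).
    by rewrite ler_expR; move: hb; generalize (ln (10 * M)) => L; lra.
  rewrite expRD expRN expRM_natr lnK ?posrE; last by lra.
  have -> : (10 * M) ^+ 2 = 100 * M ^+ 2 by ring.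
  have M2 : 0 <= 100 * M ^+ 2 by rewrite mulr_ge0 // sqr_ge0.
  apply: ler_wpM2l; first by rewrite invr_ge0.
  have -> : 3 / 5 = (5 / 3)^-1 :> R by field.
  have h53 : 5 / 3 <= expR (2 / 3) :> R by apply: le_trans (expR_ge1Dx _); lra.
  by rewrite expRN lef_pV2 ?posrE ?expR_gt0 //; lra.
have tt0 : 0 <= (1 + t) / (1 - t) by rewrite divr_ge0; lra.
have ht : ((1 + t) / (1 - t)) ^+ (12 * (m - 2)) <= (4 / 3) ^+ 4.
  apply: le_trans expR1_le.
  have -> : expR 1 = expR (12 * (m - 2))%:R^-1 ^+ (12 * (m - 2)) :> R.
    by rewrite -expRM_natr mulVf // pnatr_eq0 -lt0n.
  have base : (1 + t) / (1 - t) <= expR (12 * (m - 2))%:R^-1.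
    apply: le_trans (expR_ge1Dx _); rewrite natrM -/M ler_pdivrMr; last by lra.
    have -> : (12 * M)^-1 = 3 * t by rewrite /t; field; lra.
    by nra.
  by apply: lerXn2r; rewrite // nnegrE expR_ge0.
apply: (@le_trans _ _ ((100 * M ^+ 2)^-1 * (3 / 5) * (4 / 3) * (4 / 3) ^+ 4)).
  apply: ler_pM; [by rewrite mulr_ge0 ?expR_ge0|exact: exprn_ge0| |exact: ht].
  exact: ler_wpM2r hx.
rewrite /t.
have -> : (36 * M)^-1 = (100 * M ^+ 2)^-1 * (100 / 36 * M) by field; lra.
rewrite -!mulrA ler_wpM2l ?invr_ge0 ?mulr_ge0 ?exprn_ge0 //; lra.
Qed.

End Constants.

Theorem theorem4 (R : realType) (m : nat) (beta : R) (r t : nat) :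
  (3 <= m)%N ->
  ln (10 * (m - 2)%:R) / 2 + 6^-1 < beta ->
  (1 <= r)%N -> (1 <= t)%N ->
  exists (V : R) (VR : nat -> R),
    (* V_beta(Rl) = lim_{T->oo} -(1/T) log <W_{gamma_{Rl,T}}>, for every choice of
       axis-parallel rectangles gamma_{Rl,T} with side lengths Rl, T *)
    (forall (Rl : nat), (1 <= Rl)%N ->
       forall (i j : nat -> 'I_m) (a : nat -> zvert m),
         (forall T, i T != j T) ->
         (fun T : nat => - ln (rect_wilson beta (i T) (j T) (a T) Rl T) / T%:R)
           @ \oo --> VR Rl) /\
    (* V_beta = lim_{Rl -> oo} V_beta(Rl) *)
    VR @ \oo --> V /\
    (* main claim *)
    (forall (i j : nat -> 'I_m) (a : nat -> zvert m),
       (forall n, i n != j n) ->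
       (fun n : nat =>
          - ln (rect_wilson beta (i n) (j n) (a n) (r * n) (t * n)) / (r * n + t * n)%:R)
         @ \oo --> V).
Proof.
move=> m3 hb r1 t1.
have [tau0 tau1 xst] := polymer_constants m3 hb.
set tau := (36 * (m - 2)%:R)^-1 in tau0 tau1 xst.
set x := expR (- (4 * beta)) in xst.
have x0 : 0 <= x by exact: expR_ge0.
have s1 : 1 < 4 / 3 :> R by lra.
pose i0 : 'I_m := Ordinal (ltn_trans (isT : (0 < 2)%N) m3).
pose j0 : 'I_m := Ordinal (ltn_trans (isT : (1 < 2)%N) m3).
have ij0 : i0 != j0 by [].
(* One reference rectangle at the origin stands for all: by invariance the plane and the corner may
   vary arbitrarily along the sequences. *)
pose f Rl T := free x i0 j0 0 Rl T.
have fE (i j : 'I_m) (a : zvert m) Rl T : i != j -> - ln (rect_wilson beta i j a Rl T) = f Rl T.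
  move=> ij; rewrite (ln_rect_wilson m3 x0 s1 tau0 tau1 xst) //.
  exact: (free_inv m3 x0 s1 tau0 tau1 xst).
pose c0 := tau / (1 - tau).
have c00 : 0 <= c0 by rewrite divr_ge0 // subr_ge0 ltW.
(* A common constant for the second-difference bound and the perimeter bound; the value of [geo] at
   [s = 4/3] appears in the latter. *)
pose K := Num.max (4 * c0) (2 * c0 * (2 * ((4 / 3) / (4 / 3 - 1)))).
have K0 : 0 <= K by rewrite le_max mulr_ge0.
have [|||a b|a b|a b|V [VR [H1 H2 H3]]] :=
  @perimeter_asymptotics R (4 / 3)^-1 K f.
- by rewrite invr_gt0; lra.
- by rewrite invf_lt1; lra.
- exact: K0.
- rewrite /f free_swap; apply: (free_inv m3 x0 s1 tau0 tau1 xst) => //.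
- apply: le_trans (free_perimeter m3 x0 s1 tau0 tau1 xst 0 a b ij0) _.
  by rewrite ler_wpM2r // le_max lexx orbT.
- apply: le_trans (free_diff2 m3 x0 s1 tau0 tau1 xst 0 a b ij0) _.
  by rewrite !ler_wpM2r ?exprn_ge0 ?invr_ge0 // ?le_max ?lexx //; lra.
exists V, VR; split; last split=> //.
- move=> Rl _ i j a ij; under eq_fun do rewrite fE //; exact: H1.
- by move=> i j a ij; under eq_fun do rewrite fE //; exact: H3.
Qed.
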